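(* Let $\alpha>0$ and put $k=\theta_2(e^{-\pi\alpha^2})^2/\theta_3(e^{-\pi\alpha^2})^2$ and $k'=\theta_4(e^{-\pi\alpha^2})^2/\theta_3(e^{-\pi\alpha^2})^2$ (so $k,k'\in(0,1)$ and $k^2+k'^2=1$). Let $A(\alpha;1)=\min_{(x,y)\in\mathbb{R}^2}p_\alpha(x,y;1)$ and $B(\alpha;1)=\max_{(x,y)\in\mathbb{R}^2}p_\alpha(x,y;1)$. Then $$A(\alpha;1)=\theta_4(e^{-\pi\alpha^2})\theta_4(e^{-\pi\alpha^{-2}})=\theta_2(e^{-\pi\alpha^2})\theta_2(e^{-\pi\alpha^{-2}})=\sqrt{k\,k'\,{}_2F_1\!\left(\tfrac12,\tfrac12;1;k^2\right){}_2F_1\!\left(\tfrac12,\tfrac12;1;k'^2\right)},$$ $$B(\alpha;1)=\theta_3(e^{-\pi\alpha^2})\theta_3(e^{-\pi\alpha^{-2}})=\sqrt{{}_2F_1\!\left(\tfrac12,\tfrac12;1;k^2\right){}_2F_1\!\left(\tfrac12,\tfrac12;1;k'^2\right)}.$$ In particular, $A(\alpha;1)$ and $B(\alpha;1)$ depend on $\alpha$ only through $k'$, and $\alpha\mapsto k'$ is a bijection from $\mathbb{R}_+$ onto $(0,1)$.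
   Context: For $\alpha>0$, $t>0$, $(x,y)\in\mathbb{R}^2$: $p_\alpha(x,y;t)=\sum_{(k,l)\in\mathbb{Z}^2}e^{-\pi t(\alpha^2k^2+\alpha^{-2}l^2)}e^{2\pi i(kx+ly)}$ is the (rescaled) heat kernel of the rectangular torus $\mathbb{R}^2/(\alpha^{-1}\mathbb{Z}\times\alpha\mathbb{Z})$ of area 1. Theta-nulls for $0<q<1$: $\theta_2(q)=\sum_{k\in\mathbb{Z}} q^{(k+1/2)^2}$, $\theta_3(q)=\sum_{k\in\mathbb{Z}} q^{k^2}$, $\theta_4(q)=\sum_{k\in\mathbb{Z}}(-1)^k q^{k^2}$. ${}_2F_1(a,b;c;x)=\sum_{n\ge0}\frac{(a)_n(b)_n}{(c)_n}\frac{x^n}{n!}$, $(z)_n=\Gamma(z+n)/\Gamma(z)$. *)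

(* Defs.v *)
From Stdlib Require Import Reals Lra ZArith ClassicalEpsilon.
Open Scope R_scope.

(* Limit of a real sequence (the value l with Un_cv u l, chosen by Hilbert's
   epsilon; unspecified if the sequence diverges). *)
Definition lim_seq (u : nat -> R) : R :=
  epsilon (inhabits 0) (fun l => Un_cv u l).

Definition Zpartial (f : Z -> R) (N : nat) : R :=
  sum_f_R0 (fun i => f (Z.of_nat i - Z.of_nat N)%Z) (2 * N).

Definition Zsum (f : Z -> R) : R := lim_seq (Zpartial f).

Definition Z2partial (f : Z -> Z -> R) (N : nat) : R :=
  sum_f_R0 (fun i => sum_f_R0 (fun j =>
     f (Z.of_nat i - Z.of_nat N)%Z (Z.of_nat j - Z.of_nat N)%Z) (2 * N)) (2 * N).

Definition Z2sum (f : Z -> Z -> R) : R := lim_seq (Z2partial f).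

Definition theta2 (q : R) : R := Zsum (fun k => Rpower q ((IZR k + / 2) ^ 2)).
Definition theta3 (q : R) : R := Zsum (fun k => powerRZ q (k * k)).
Definition theta4 (q : R) : R :=
  Zsum (fun k => powerRZ (-1) k * powerRZ q (k * k)).

(* Heat kernel p_alpha(x,y;t).  The complex terms e^{2 pi i (kx+ly)} pair up
   ((k,l) with (-k,-l)), so the sum is real and equals the sum of the real
   parts e^{...} cos(2 pi (kx+ly)); we write it with the cosine. *)
Definition p_alpha (alpha x y t : R) : R :=
  Z2sum (fun k l =>
    exp (- PI * t * (alpha ^ 2 * IZR k ^ 2 + / alpha ^ 2 * IZR l ^ 2))
    * cos (2 * PI * (IZR k * x + IZR l * y))).

Fixpoint poch (z : R) (n : nat) : R :=
  match n with
  | O => 1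
  | S m => poch z m * (z + INR m)
  end.

Definition hyp2F1 (a b c x : R) : R :=
  lim_seq (sum_f_R0 (fun n => poch a n * poch b n / poch c n * x ^ n / INR (fact n))).

Definition kmod (alpha : R) : R :=
  let q := exp (- PI * alpha ^ 2) in (theta2 q) ^ 2 / (theta3 q) ^ 2.
Definition kmod' (alpha : R) : R :=
  let q := exp (- PI * alpha ^ 2) in (theta4 q) ^ 2 / (theta3 q) ^ 2.

(* Main.v *)
Require Import Defs.
From Stdlib Require Import Reals.
From Stdlib Require Import Lra Lia Psatz ZArith List Classical ClassicalEpsilon.
From Coquelicot Require Import Coquelicot.
Import ListNotations.
Open Scope R_scope.

(** The heat kernel at time 1 is a product of two one-variable theta functions, which the
    Jacobi triple product shows to be smallest at the half period, so that extrema are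
    products of theta-nulls.  Poisson summation is avoided.  Rotating the lattice
    (m, n) -> (m - e, m + e) gives the duplication formulas q -> q^2 of the theta-nulls; with
    Landen's transformation of F = 2F1(1/2,1/2;1;.) they show that q -> q^2 leaves
    F(k^2)/theta3^2 invariant and doubles F(k'^2)/theta3^2.  Letting q -> 0, where F(1-x) ~ ln(1/x)/pi by
    Wallis' product, yields theta3^2 = F(k^2) and F(k'^2) = alpha^2 F(k^2).  Since
    F(1-x)/F(x) is strictly monotone, the last identity determines k from alpha and conversely;
    this gives both the bijection and the exchange of k and k' under alpha -> 1/alpha. *)

(** * Unconditional sums *)

(** The series in the statement are chosen limits of symmetric partial sums, which do not permit
    reindexing; for unconditional sums the lattice rotation is just a bijection of index types. At
    the half period the theta series alternates, so no termwise comparison shows that it is minimal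
    there. In the product at z = exp (i phi) each factor is 1 + q^(4j-2) + 2 q^(2j-1) cos phi; all
    of them are nonnegative and smallest at phi = PI simultaneously. Finite products suffice, since
    their coefficients are explicit and the passage to the limit is dominated convergence. The limit
    only yields theta4 >= 0; strict positivity comes from the duplication formulas. The equality of
    the theta4 and theta2 products relates the nomes exp (-s) and exp (- PI^2 / s), usually by the
    modular transformation. Its substitute is the recovery of s from the modulus, F(1 - k^2) /
    F(k^2) = s / PI. The constant arises because theta2 has size exp (- s / 4), so that ln (1 / k^2)
    = s + O(1); n duplications followed by division by 2^n remove the bounded error. *)

Definition lsum {A : Type} (f : A -> R) (l : list A) : R :=
  fold_right (fun a r => f a + r) 0 l.

(* Convergence along the net of finite subsets, hence independent of any enumeration. *)
Definition has_sum {A : Type} (f : A -> R) (s : R) : Prop :=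
  forall eps, 0 < eps -> exists L0, forall L, NoDup L -> incl L0 L ->
    Rabs (lsum f L - s) < eps.

Definition abs_summable {A : Type} (f : A -> R) : Prop :=
  exists M, forall L, NoDup L -> lsum (fun a => Rabs (f a)) L <= M.

Lemma eq_dec_classic {A : Type} (x y : A) : {x = y} + {x <> y}.
Proof. apply excluded_middle_informative. Qed.

Lemma lsum_app {A} (f : A -> R) l1 l2 : lsum f (l1 ++ l2) = lsum f l1 + lsum f l2.
Proof. induction l1; simpl; lra. Qed.

Lemma lsum_ext {A} (f g : A -> R) l : (forall a, In a l -> f a = g a) -> lsum f l = lsum g l.
Proof.
  induction l; simpl; intros H; [easy|].
  rewrite H, IHl; auto.
Qed.

Lemma lsum_plus {A} (f g : A -> R) l :
  lsum (fun a => f a + g a) l = lsum f l + lsum g l.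
Proof. induction l; simpl; lra. Qed.

Lemma lsum_scal {A} c (f : A -> R) l : lsum (fun a => c * f a) l = c * lsum f l.
Proof. induction l; simpl; [|rewrite IHl]; lra. Qed.

Lemma lsum_le {A} (f g : A -> R) l : (forall a, f a <= g a) -> lsum f l <= lsum g l.
Proof. intros H; induction l; simpl; [lra|]. specialize (H a); lra. Qed.

Lemma lsum_nonneg {A} (f : A -> R) l : (forall a, 0 <= f a) -> 0 <= lsum f l.
Proof. intros H; induction l; simpl; [lra|]. specialize (H a); lra. Qed.

Lemma lsum_map {A B} (f : B -> R) (h : A -> B) l : lsum f (map h l) = lsum (fun a => f (h a)) l.
Proof. induction l; simpl; [easy|]. now rewrite IHl. Qed.

Lemma lsum_incl_le {A} (f : A -> R) l l' : (forall a, 0 <= f a) ->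
  NoDup l -> incl l l' -> lsum f l <= lsum f l'.
Proof.
  intros Hf; revert l'; induction l as [|a l IH]; intros l' Hn Hi.
  - now apply lsum_nonneg.
  - destruct (in_split a l') as [l1 [l2 ->]]; [apply Hi; now left|].
    inversion_clear Hn.
    assert (lsum f l <= lsum f (l1 ++ l2)).
    { apply IH; [easy|]. intros b Hb.
      assert (Hb' : In b (l1 ++ a :: l2)) by (apply Hi; now right).
      apply in_app_iff in Hb'; apply in_app_iff; simpl in Hb'.
      destruct Hb' as [|[->|]]; tauto. }
    rewrite lsum_app in *; simpl in *; lra.
Qed.

(** [has_sum] tests only lists without repetition, whereas common supersets of several lists are
    formed by [++]; this restores [NoDup]. *)
Lemma incl_nodup_dec {A} (l : list A) :
  exists l', NoDup l' /\ incl l l' /\ incl l' l.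
Proof.
  exists (nodup eq_dec_classic l); split; [apply NoDup_nodup|].
  split; intros a; apply nodup_In.
Qed.

Lemma has_sum_unique {A} (f : A -> R) s t : has_sum f s -> has_sum f t -> s = t.
Proof.
  intros Hs Ht.
  destruct (Req_dec s t) as [|Hne]; [easy|exfalso].
  assert (He : 0 < Rabs (s - t) / 2) by (assert (0 < Rabs (s - t)) by (apply Rabs_pos_lt; lra); lra).
  destruct (Hs _ He) as [L1 H1]; destruct (Ht _ He) as [L2 H2].
  destruct (incl_nodup_dec (L1 ++ L2)) as [L [Hn [Hi _]]].
  specialize (H1 L Hn (fun a h => Hi a (in_or_app _ _ _ (or_introl h)))).
  specialize (H2 L Hn (fun a h => Hi a (in_or_app _ _ _ (or_intror h)))).
  revert H1 H2; clear; intros H1 H2.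
  unfold Rabs in *; repeat destruct Rcase_abs; lra.
Qed.

Lemma has_sum_ext {A} (f g : A -> R) s : (forall a, f a = g a) -> has_sum f s -> has_sum g s.
Proof.
  intros H Hs e He; destruct (Hs e He) as [L0 HL]; exists L0; intros L Hn Hi.
  rewrite <- (lsum_ext f g); auto.
Qed.

Lemma has_sum_plus {A} (f g : A -> R) s t : has_sum f s -> has_sum g t ->
  has_sum (fun a => f a + g a) (s + t).
Proof.
  intros Hs Ht e He.
  destruct (Hs (e/2)) as [L1 H1]; [lra|]; destruct (Ht (e/2)) as [L2 H2]; [lra|].
  exists (L1 ++ L2); intros L Hn Hi.
  specialize (H1 L Hn (fun a h => Hi a (in_or_app _ _ _ (or_introl h)))).
  specialize (H2 L Hn (fun a h => Hi a (in_or_app _ _ _ (or_intror h)))).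
  rewrite lsum_plus.
  revert H1 H2; clear; intros H1 H2.
  unfold Rabs in *; repeat destruct Rcase_abs; lra.
Qed.

Lemma has_sum_scal {A} c (f : A -> R) s : has_sum f s -> has_sum (fun a => c * f a) (c * s).
Proof.
  intros Hs e He.
  assert (Hc : 0 < Rabs c + 1) by (pose proof (Rabs_pos c); lra).
  destruct (Hs (e / (Rabs c + 1))) as [L0 HL]; [now apply Rdiv_lt_0_compat|].
  exists L0; intros L Hn Hi; specialize (HL L Hn Hi).
  rewrite lsum_scal, <- Rmult_minus_distr_l, Rabs_mult.
  pose proof (Rabs_pos (lsum f L - s)).
  apply Rle_lt_trans with ((Rabs c + 1) * Rabs (lsum f L - s)); [nra|].
  apply (Rmult_lt_compat_l (Rabs c + 1)) in HL; [|easy].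
  replace ((Rabs c + 1) * (e / (Rabs c + 1))) with e in HL by (field; lra); easy.
Qed.

Lemma has_sum_lsum_le {A} (f : A -> R) s L : (forall a, 0 <= f a) -> has_sum f s ->
  NoDup L -> lsum f L <= s.
Proof.
  intros Hf Hs Hn. apply Rnot_lt_le; intros Hlt.
  destruct (Hs (lsum f L - s)) as [L0 HL]; [lra|].
  destruct (incl_nodup_dec (L0 ++ L)) as [L' [Hn' [Hi _]]].
  specialize (HL L' Hn' (fun a h => Hi a (in_or_app _ _ _ (or_introl h)))).
  assert (lsum f L <= lsum f L').
  { apply lsum_incl_le; auto. intros a h; apply Hi, in_or_app; auto. }
  apply Rabs_def2 in HL; lra.
Qed.

Lemma has_sum_le_bound {A} (f : A -> R) s M : has_sum f s ->
  (forall L, NoDup L -> lsum f L <= M) -> s <= M.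
Proof.
  intros Hs HM. apply Rnot_lt_le; intros Hlt.
  destruct (Hs (s - M)) as [L0 HL]; [lra|].
  destruct (incl_nodup_dec L0) as [L' [Hn' [Hi _]]].
  specialize (HL L' Hn' Hi); specialize (HM L' Hn').
  apply Rabs_def2 in HL; lra.
Qed.

Lemma has_sum_reindex {A B} (h : A -> B) (h' : B -> A) (f : B -> R) s :
  (forall a, h' (h a) = a) -> (forall b, h (h' b) = b) ->
  has_sum f s -> has_sum (fun a => f (h a)) s.
Proof.
  intros H1 H2 Hs e He; destruct (Hs e He) as [L0 HL].
  exists (map h' L0); intros L Hn Hi.
  rewrite <- lsum_map; apply HL.
  - apply NoDup_map_NoDup_ForallPairs; [|easy].
    intros a b _ _ E. now rewrite <- (H1 a), E, H1.
  - intros b Hb; rewrite <- (H2 b); apply in_map, Hi, in_map, Hb.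
Qed.

Fixpoint lefts {A B} (l : list (A + B)) : list A :=
  match l with [] => [] | inl a :: l => a :: lefts l | inr _ :: l => lefts l end.
Fixpoint rights {A B} (l : list (A + B)) : list B :=
  match l with [] => [] | inr a :: l => a :: rights l | inl _ :: l => rights l end.

Lemma in_lefts {A B} (l : list (A + B)) a : In a (lefts l) <-> In (inl a) l.
Proof.
  induction l as [|[b|b] l IH]; simpl; [tauto| |]; rewrite IH.
  - intuition congruence.
  - intuition congruence.
Qed.

Lemma in_rights {A B} (l : list (A + B)) a : In a (rights l) <-> In (inr a) l.
Proof.
  induction l as [|[b|b] l IH]; simpl; [tauto| |]; rewrite IH; intuition congruence.
Qed.

Lemma NoDup_lefts_rights {A B} (l : list (A + B)) :
  NoDup l -> NoDup (lefts l) /\ NoDup (rights l).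
Proof.
  induction l as [|[b|b] l IH]; simpl; intros H; [split; constructor| |];
    inversion_clear H; destruct (IH ltac:(assumption)) as [Ha Hb]; split;
    try assumption; constructor; try assumption.
  - now rewrite in_lefts.
  - now rewrite in_rights.
Qed.

Lemma lsum_sum_type {A B} (f : A + B -> R) l :
  lsum f l = lsum (fun a => f (inl a)) (lefts l) + lsum (fun b => f (inr b)) (rights l).
Proof. induction l as [|[b|b] l IH]; simpl; rewrite ?IH; lra. Qed.

(** Serves to split a sum over the lattice into its two parity classes. *)
Lemma has_sum_sum_type {A B} (f : A + B -> R) s t :
  has_sum (fun a => f (inl a)) s -> has_sum (fun b => f (inr b)) t -> has_sum f (s + t).
Proof.
  intros Hs Ht e He.
  destruct (Hs (e/2)) as [L1 H1]; [lra|]; destruct (Ht (e/2)) as [L2 H2]; [lra|].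
  exists (map inl L1 ++ map inr L2); intros L Hn Hi.
  destruct (NoDup_lefts_rights L Hn) as [Hl Hr].
  specialize (H1 _ Hl); specialize (H2 _ Hr).
  rewrite lsum_sum_type.
  assert (K1 : incl L1 (lefts L)).
  { intros a h; apply in_lefts, Hi, in_or_app; left; now apply in_map. }
  assert (K2 : incl L2 (rights L)).
  { intros a h; apply in_rights, Hi, in_or_app; right; now apply in_map. }
  specialize (H1 K1); specialize (H2 K2); revert H1 H2; clear; intros H1 H2.
  unfold Rabs in *; repeat destruct Rcase_abs; lra.
Qed.

(** The sum is the supremum of the finite sums: a list that nearly attains it keeps doing so when
    enlarged. *)
Lemma has_sum_exists_nonneg {A} (f : A -> R) M : (forall a, 0 <= f a) ->
  (forall L, NoDup L -> lsum f L <= M) -> exists s, has_sum f s.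
Proof.
  intros Hf HM.
  destruct (completeness (fun x => exists L, NoDup L /\ x = lsum f L)) as [s [Hub Hl]].
  - exists M; intros x [L [Hn ->]]; auto.
  - exists 0, []; split; [constructor|easy].
  - exists s; intros e He.
    assert (Hex : exists L, NoDup L /\ s - e < lsum f L).
    { apply NNPP; intros Hno.
      assert (s <= s - e); [|lra].
      apply Hl; intros x [L [Hn ->]].
      apply Rnot_lt_le; intros Hlt; apply Hno; now exists L. }
    destruct Hex as [L0 [Hn0 H0]]; exists L0; intros L Hn Hi.
    assert (lsum f L0 <= lsum f L) by now apply lsum_incl_le.
    assert (lsum f L <= s) by (apply Hub; now exists L).
    apply Rabs_def1; lra.
Qed.

Lemma abs_summable_dom {A} C (f g : A -> R) : 0 <= C -> (forall a, Rabs (f a) <= C * Rabs (g a)) ->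
  abs_summable g -> abs_summable f.
Proof.
  intros HC H [M HM]; exists (C * M); intros L Hn.
  apply Rle_trans with (lsum (fun a => C * Rabs (g a)) L); [now apply lsum_le|].
  rewrite lsum_scal; apply Rmult_le_compat_l; auto.
Qed.

Lemma abs_summable_reindex {A B} (h : A -> B) (f : B -> R) :
  (forall a b, h a = h b -> a = b) -> abs_summable f -> abs_summable (fun a => f (h a)).
Proof.
  intros Hh [M HM]; exists M; intros L Hn.
  rewrite <- (lsum_map (fun b => Rabs (f b)) h); apply HM.
  apply NoDup_map_NoDup_ForallPairs; [|easy]; intros a b _ _; apply Hh.
Qed.

(** Write f = (f + |f|) - |f|, a difference of two nonnegative families with bounded finite sums. *)
Lemma abs_summable_has_sum {A} (f : A -> R) : abs_summable f -> exists s, has_sum f s.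
Proof.
  intros [M HM].
  destruct (has_sum_exists_nonneg (fun a => Rabs (f a)) M) as [s Hs]; auto.
  { intros; apply Rabs_pos. }
  destruct (has_sum_exists_nonneg (fun a => f a + Rabs (f a)) (2 * M)) as [t Ht].
  - intros a; pose proof (Rle_abs (- f a)); rewrite Rabs_Ropp in H; lra.
  - intros L Hn; apply Rle_trans with (lsum (fun a => 2 * Rabs (f a)) L).
    + apply lsum_le; intros a; pose proof (Rle_abs (f a)); lra.
    + rewrite lsum_scal; specialize (HM L Hn); lra.
  - exists (t + -1 * s).
    apply has_sum_ext with (fun a => (f a + Rabs (f a)) + -1 * Rabs (f a)); [intros; lra|].
    apply has_sum_plus; [easy|]; now apply has_sum_scal.
Qed.

Lemma lsum_list_prod {A B} (f : A -> R) (g : B -> R) l1 l2 :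
  lsum (fun p => f (fst p) * g (snd p)) (list_prod l1 l2) = lsum f l1 * lsum g l2.
Proof.
  induction l1 as [|a l1 IH]; simpl; [lra|].
  rewrite lsum_app, IH, lsum_map; simpl; rewrite lsum_scal; lra.
Qed.

Lemma NoDup_list_prod' {A B} (l1 : list A) (l2 : list B) :
  NoDup l1 -> NoDup l2 -> NoDup (list_prod l1 l2).
Proof.
  intros H1 H2; induction H1 as [|a l1 Ha H1 IH]; simpl; [constructor|].
  apply NoDup_app; [|easy|].
  - apply NoDup_map_NoDup_ForallPairs; [|easy]. intros x y _ _ E; now inversion E.
  - intros [x y] Hx Hy; apply in_map_iff in Hx; destruct Hx as [z [E _]].
    inversion E; subst; apply in_prod_iff in Hy; tauto.
Qed.

Lemma abs_summable_prod {A B} (f : A -> R) (g : B -> R) :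
  abs_summable f -> abs_summable g ->
  abs_summable (fun p : A * B => f (fst p) * g (snd p)).
Proof.
  intros [M HM] [N HN]; exists (M * N); intros L Hn.
  destruct (incl_nodup_dec (map fst L)) as [L1 [Hn1 [Hi1 _]]].
  destruct (incl_nodup_dec (map snd L)) as [L2 [Hn2 [Hi2 _]]].
  rewrite (lsum_ext _ (fun p => Rabs (f (fst p)) * Rabs (g (snd p))))
    by (intros; apply Rabs_mult).
  apply Rle_trans with (lsum (fun p => Rabs (f (fst p)) * Rabs (g (snd p))) (list_prod L1 L2)).
  - apply lsum_incl_le; [|easy|].
    + intros a; apply Rmult_le_pos; apply Rabs_pos.
    + intros [x y] Hp; apply in_prod; [apply Hi1; now apply (in_map fst L (x, y))|].
      apply Hi2; now apply (in_map snd L (x, y)).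
  - rewrite (lsum_list_prod (fun a => Rabs (f a)) (fun b => Rabs (g b))).
    apply Rmult_le_compat; auto; apply lsum_nonneg; intros; apply Rabs_pos.
Qed.

(** The product family has some sum [w] by absolute summability. On rectangles [list_prod K1 K2] its
    finite sums factor, and rectangles are cofinal among finite sets, so [w] must be [s * t]. *)
Lemma has_sum_prod {A B} (f : A -> R) (g : B -> R) s t :
  abs_summable f -> abs_summable g -> has_sum f s -> has_sum g t ->
  has_sum (fun p : A * B => f (fst p) * g (snd p)) (s * t).
Proof.
  intros Af Ag Hs Ht.
  destruct (abs_summable_has_sum _ (abs_summable_prod f g Af Ag)) as [w Hw].
  replace (s * t) with w; [easy|].
  destruct (Req_dec w (s * t)) as [|Hne]; [easy|exfalso].
  set (e := Rabs (w - s * t)).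
  assert (He : 0 < e) by (apply Rabs_pos_lt; lra).
  set (c := Rabs s + Rabs t + 1).
  assert (Hc : 1 <= c) by (unfold c; pose proof (Rabs_pos s); pose proof (Rabs_pos t); lra).
  (* With both factors within [d <= 1] of their limits, the product errs by at most d (1 + |s| +
     |t|) = d c <= e / 2; the other half of [e] goes to [w]. *)
  set (d := Rmin 1 (e / (2 * c))).
  assert (Hd : 0 < d).
  { apply Rmin_glb_lt; [lra|]; apply Rdiv_lt_0_compat; lra. }
  assert (Hd1 : d <= 1) by apply Rmin_l.
  assert (Hdc : d * c <= e / 2).
  { apply Rle_trans with (e / (2 * c) * c).
    - apply Rmult_le_compat_r; [lra|apply Rmin_r].
    - right; field; lra. }
  destruct (Hw (e / 2)) as [L0 H0]; [lra|].
  destruct (Hs d Hd) as [L1 H1]; destruct (Ht d Hd) as [L2 H2].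
  destruct (incl_nodup_dec (L1 ++ map fst L0)) as [K1 [Hn1 [Hi1 _]]].
  destruct (incl_nodup_dec (L2 ++ map snd L0)) as [K2 [Hn2 [Hi2 _]]].
  specialize (H1 K1 Hn1 (fun a h => Hi1 a (in_or_app _ _ _ (or_introl h)))).
  specialize (H2 K2 Hn2 (fun a h => Hi2 a (in_or_app _ _ _ (or_introl h)))).
  specialize (H0 (list_prod K1 K2) (NoDup_list_prod' _ _ Hn1 Hn2)).
  rewrite lsum_list_prod in H0.
  assert (Hincl : incl L0 (list_prod K1 K2)).
  { intros [x y] Hp; apply in_prod.
    - apply Hi1, in_or_app; right; now apply (in_map fst L0 (x, y)).
    - apply Hi2, in_or_app; right; now apply (in_map snd L0 (x, y)). }
  specialize (H0 Hincl).
  set (x := lsum f K1) in *; set (y := lsum g K2) in *.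
  assert (Rabs (x * y - s * t) <= d * c).
  { replace (x * y - s * t) with ((x - s) * (y - t) + (x - s) * t + s * (y - t)) by ring.
    eapply Rle_trans; [apply Rabs_triang|].
    eapply Rle_trans; [apply Rplus_le_compat_r, Rabs_triang|].
    rewrite !Rabs_mult.
    pose proof (Rabs_pos (x - s)); pose proof (Rabs_pos (y - t)).
    pose proof (Rabs_pos s); pose proof (Rabs_pos t).
    assert (Rabs (x - s) * Rabs (y - t) <= d * 1) by (apply Rmult_le_compat; lra).
    unfold c; nra. }
  assert (e <= Rabs (x * y - w) + Rabs (x * y - s * t)).
  { unfold e. replace (w - s * t) with (- (x * y - w) + (x * y - s * t)) by ring.
    eapply Rle_trans; [apply Rabs_triang|]. rewrite Rabs_Ropp; lra. }
  lra.
Qed.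

(** Both g + f and g - f are nonnegative, so their finite sums stay below their totals; the two
    inequalities together bound the tail of f by that of g. *)
Lemma has_sum_tail {A} (f g : A -> R) S G L : (forall a, Rabs (f a) <= g a) ->
  has_sum f S -> has_sum g G -> NoDup L -> Rabs (S - lsum f L) <= G - lsum g L.
Proof.
  intros Hd Hf Hg Hn.
  assert (H1 : lsum (fun a => g a + f a) L <= G + S).
  { apply has_sum_lsum_le; [|now apply has_sum_plus|easy].
    intros a; specialize (Hd a); pose proof (Rle_abs (- f a)); rewrite Rabs_Ropp in H; lra. }
  assert (H2 : lsum (fun a => g a + -1 * f a) L <= G + -1 * S).
  { apply has_sum_lsum_le; [|apply has_sum_plus; [easy|now apply has_sum_scal]|easy].
    intros a; specialize (Hd a); pose proof (Rle_abs (f a)); lra. }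
  rewrite lsum_plus in H1, H2; rewrite lsum_scal in H2.
  apply Rabs_le; lra.
Qed.

Lemma lsum_cv {A} (fN : nat -> A -> R) (f : A -> R) L :
  (forall a, Un_cv (fun N => fN N a) (f a)) -> Un_cv (fun N => lsum (fN N) L) (lsum f L).
Proof.
  intros H; induction L as [|a L IH]; simpl.
  - intros e He; exists 0%nat; intros; rewrite Rdist_eq; easy.
  - now apply CV_plus.
Qed.

(** Dominated convergence: one finite list makes the tail of [g], hence the tails of [f] and of
    every [fN N], smaller than e / 3, and on that list the convergence is termwise. *)
Lemma tannery {A} (fN : nat -> A -> R) (f g : A -> R) (SN : nat -> R) S G :
  (forall a, Un_cv (fun N => fN N a) (f a)) ->
  (forall N a, Rabs (fN N a) <= g a) -> (forall a, Rabs (f a) <= g a) ->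
  (forall N, has_sum (fN N) (SN N)) -> has_sum f S -> has_sum g G -> Un_cv SN S.
Proof.
  intros Hc HdN Hd HN Hf Hg e He.
  destruct (Hg (e / 3)) as [L0 H0]; [lra|].
  destruct (incl_nodup_dec L0) as [L [Hn [Hi _]]].
  specialize (H0 L Hn Hi); apply Rabs_def2 in H0.
  destruct (lsum_cv fN f L Hc (e / 3)) as [N0 HN0]; [lra|].
  exists N0; intros n Hge; specialize (HN0 n Hge); unfold Rdist in *.
  pose proof (has_sum_tail f g S G L Hd Hf Hg Hn) as T1.
  pose proof (has_sum_tail _ g _ G L (HdN n) (HN n) Hg Hn) as T2.
  revert HN0 T1 T2 H0; clear; intros.
  unfold Rabs in *; repeat destruct Rcase_abs; lra.
Qed.

(** * Symmetric partial sums over the integers *)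

Lemma lim_seq_unique u l : Un_cv u l -> lim_seq u = l.
Proof.
  intros H; unfold lim_seq.
  assert (Hs : Un_cv u (epsilon (inhabits 0) (fun l => Un_cv u l)))
    by (apply epsilon_spec; now exists l).
  exact (UL_sequence _ _ _ Hs H).
Qed.

Definition zrange (N : nat) : list Z :=
  map (fun i => (Z.of_nat i - Z.of_nat N)%Z) (seq 0 (S (2 * N))).

Lemma sum_f_R0_lsum f N : sum_f_R0 f N = lsum f (seq 0 (S N)).
Proof.
  induction N as [|N IH]; [simpl; lra|].
  rewrite seq_S, lsum_app, <- IH; simpl; lra.
Qed.

Lemma Zpartial_lsum f N : Zpartial f N = lsum f (zrange N).
Proof. unfold Zpartial, zrange; rewrite lsum_map; apply sum_f_R0_lsum. Qed.

Lemma in_zrange N k : In k (zrange N) <-> (Z.abs k <= Z.of_nat N)%Z.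
Proof.
  unfold zrange; rewrite in_map_iff; split.
  - intros [i [<- Hi]]; apply in_seq in Hi; lia.
  - intros H; exists (Z.to_nat (k + Z.of_nat N)); rewrite in_seq; lia.
Qed.

Lemma NoDup_zrange N : NoDup (zrange N).
Proof.
  apply NoDup_map_NoDup_ForallPairs; [|apply seq_NoDup].
  intros a b _ _; lia.
Qed.

Lemma incl_zrange L : exists N0, forall N, (N0 <= N)%nat -> incl L (zrange N).
Proof.
  induction L as [|k L [N0 IH]]; [exists 0%nat; intros N _ k []|].
  exists (Nat.max N0 (Z.abs_nat k)); intros N HN j [<-|Hj].
  - apply in_zrange; lia.
  - apply (IH N); [lia|easy].
Qed.

Lemma has_sum_Zpartial f s : has_sum f s -> Un_cv (Zpartial f) s.
Proof.
  intros H e He; destruct (H e He) as [L0 H0]; destruct (incl_zrange L0) as [N0 HN].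
  exists N0; intros n Hn; rewrite Zpartial_lsum; apply H0; [apply NoDup_zrange|now apply HN].
Qed.

Lemma has_sum_Zsum f s : has_sum f s -> Zsum f = s.
Proof. intros H; now apply lim_seq_unique, has_sum_Zpartial. Qed.

Lemma Zpartial_S f N :
  Zpartial f (S N) = f (- Z.of_nat (S N))%Z + Zpartial f N + f (Z.of_nat (S N)).
Proof.
  unfold Zpartial.
  replace (2 * S N)%nat with (S (S (2 * N))) by lia.
  rewrite tech5, decomp_sum by lia.
  replace (Init.Nat.pred (S (2 * N))) with (2 * N)%nat by lia.
  cbv beta; apply f_equal2; [apply f_equal2|].
  - apply f_equal; lia.
  - apply sum_eq; intros i Hi; apply f_equal; lia.
  - apply f_equal; lia.
Qed.

Lemma lsum_geom_Z rho L : 0 < rho < 1 -> NoDup L ->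
  lsum (fun k => rho ^ Z.abs_nat k) L <= (1 + rho) / (1 - rho).
Proof.
  intros Hr Hn. destruct (incl_zrange L) as [N HN]; specialize (HN N (le_n _)).
  apply Rle_trans with (lsum (fun k => rho ^ Z.abs_nat k) (zrange N)).
  - apply lsum_incl_le; auto. intros; apply pow_le; lra.
  - rewrite <- Zpartial_lsum; clear -Hr.
    (* The exact symmetric partial sum of the two-sided geometric series; dropping its negative last
       term gives the bound. *)
    assert (E : Zpartial (fun k => rho ^ Z.abs_nat k) N = (1 + rho - 2 * rho ^ S N) / (1 - rho)).
    { induction N as [|N IH].
      - unfold Zpartial; simpl; field; lra.
      - rewrite Zpartial_S, IH.
        replace (Z.abs_nat (- Z.of_nat (S N))) with (S N) by lia.
        replace (Z.abs_nat (Z.of_nat (S N))) with (S N) by lia.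
        simpl; field; lra. }
    rewrite E; apply Rmult_le_compat_r; [left; apply Rinv_0_lt_compat; lra|].
    assert (0 < rho ^ S N) by (apply pow_lt; lra); lra.
Qed.

Lemma abs_summable_geom_Z rho : 0 < rho < 1 -> abs_summable (fun k : Z => rho ^ Z.abs_nat k).
Proof.
  intros Hr; exists ((1 + rho) / (1 - rho)); intros L Hn.
  rewrite (lsum_ext _ (fun k => rho ^ Z.abs_nat k)).
  - now apply lsum_geom_Z.
  - intros; apply Rabs_pos_eq, pow_le; lra.
Qed.

(** * Theta-nulls and their duplication formulas *)

(** This is q^(x^2) for the nome q = exp (- s); a real argument covers integers and half-integers
    alike. *)
Definition gauss (s x : R) : R := exp (- (s * x ^ 2)).

(* The nome is written [q = exp (- s)], so that [q -> q^2] is [s -> 2 s]. *)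
Definition th2 (s : R) : R := theta2 (exp (- s)).
Definition th3 (s : R) : R := theta3 (exp (- s)).
Definition th4 (s : R) : R := theta4 (exp (- s)).

Definition sg (k : Z) : R := powerRZ (-1) k.

Lemma sg_add a b : sg (a + b) = sg a * sg b.
Proof. apply powerRZ_add; lra. Qed.

Lemma sg_even a : sg (2 * a) = 1.
Proof.
  replace (2 * a)%Z with (a + a)%Z by lia; rewrite sg_add.
  unfold sg; rewrite <- powerRZ_mult.
  replace (-1 * -1) with 1 by lra; apply powerRZ_R1.
Qed.

Lemma sg_sqr a : sg a * sg a = 1.
Proof. rewrite <- sg_add, <- (sg_even a); f_equal; lia. Qed.

Lemma sg_1 : sg 1 = -1.
Proof. unfold sg; simpl; lra. Qed.

Lemma Rabs_sg a : Rabs (sg a) = 1.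
Proof.
  pose proof (sg_sqr a); unfold Rabs; destruct Rcase_abs; nra.
Qed.

(** Identifies theta4 with the theta series at the angle [PI], that is, at the half period. *)
Lemma cos_PI_IZR k : cos (PI * IZR k) = sg k.
Proof.
  assert (Hn : forall n : nat, cos (PI * INR n) = (-1) ^ n).
  { induction n as [|n IH]; [simpl; rewrite Rmult_0_r; apply cos_0|].
    rewrite S_INR, Rmult_plus_distr_l, Rmult_1_r, neg_cos, IH; simpl; lra. }
  assert (H0 : forall k, (0 <= k)%Z -> cos (PI * IZR k) = sg k).
  { intros j Hj; rewrite <- (Z2Nat.id j) by easy.
    rewrite <- INR_IZR_INZ, Hn; unfold sg; now rewrite pow_powerRZ. }
  destruct (Z_le_gt_dec 0 k); [now apply H0|].
  replace (PI * IZR k) with (- (PI * IZR (- k))) by (rewrite opp_IZR; ring).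
  rewrite cos_neg, H0 by lia.
  replace (sg (- k)) with (sg (- k) * (sg k * sg k)) by (rewrite sg_sqr; ring).
  rewrite <- Rmult_assoc, <- sg_add.
  replace (- k + k)%Z with 0%Z by lia; unfold sg; simpl; ring.
Qed.

Lemma powerRZ_exp a k : powerRZ (exp a) k = exp (a * IZR k).
Proof.
  rewrite powerRZ_Rpower by apply exp_pos.
  unfold Rpower; rewrite ln_exp; f_equal; ring.
Qed.

Lemma exp_pow_nat a n : exp a ^ n = exp (a * INR n).
Proof. now rewrite pow_powerRZ, powerRZ_exp, <- INR_IZR_INZ. Qed.

Lemma gauss_pos s x : 0 < gauss s x.
Proof. apply exp_pos. Qed.

Lemma gauss_opp s x : gauss s (- x) = gauss s x.
Proof. unfold gauss; do 2 f_equal; ring. Qed.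

(** The slack [c] accommodates the shift by 1/2: integers need c = 0, and c = 1 suffices for
    half-integers. *)
Lemma gauss_le_geom s c x k : 0 < s -> Rabs (IZR k) - c <= x ^ 2 ->
  gauss s x <= exp (s * c) * exp (- s) ^ Z.abs_nat k.
Proof.
  intros Hs Hx; rewrite exp_pow_nat, <- exp_plus; unfold gauss.
  replace (INR (Z.abs_nat k)) with (Rabs (IZR k)).
  - destruct (Rle_lt_or_eq_dec (- (s * x ^ 2)) (s * c + - s * Rabs (IZR k))) as [H|H].
    + nra.
    + left; now apply exp_increasing.
    + right; now rewrite H.
  - rewrite INR_IZR_INZ, Zabs2Nat.id_abs; symmetry; apply abs_IZR.
Qed.

Lemma gauss_le_geom_int s k : 0 < s -> gauss s (IZR k) <= exp (- s) ^ Z.abs_nat k.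
Proof.
  intros Hs; replace (exp (- s) ^ Z.abs_nat k) with (exp (s * 0) * exp (- s) ^ Z.abs_nat k)
    by (rewrite Rmult_0_r, exp_0; ring).
  apply gauss_le_geom; [easy|].
  rewrite <- abs_IZR; replace (IZR k ^ 2) with (IZR (k * k)) by (rewrite mult_IZR; ring).
  rewrite Rminus_0_r; apply IZR_le; nia.
Qed.

Lemma gauss_le_geom_half s k : 0 < s ->
  gauss s (IZR k + / 2) <= exp (s * 1) * exp (- s) ^ Z.abs_nat k.
Proof.
  intros Hs; apply gauss_le_geom; [easy|].
  rewrite <- abs_IZR.
  replace ((IZR k + / 2) ^ 2) with (IZR (k * k + k) + / 4)
    by (rewrite plus_IZR, mult_IZR; field).
  rewrite <- minus_IZR.
  assert (IZR (Z.abs k - 1) <= IZR (k * k + k)) by (apply IZR_le; nia). lra.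
Qed.

Lemma exp_opp_bounds s : 0 < s -> 0 < exp (- s) < 1.
Proof.
  intros Hs; split; [apply exp_pos|].
  rewrite <- exp_0; apply exp_increasing; lra.
Qed.

Lemma abs_summable_gauss s : 0 < s -> abs_summable (fun k : Z => gauss s (IZR k)).
Proof.
  intros Hs; pose proof (exp_opp_bounds s Hs).
  apply abs_summable_dom with 1 (fun k : Z => exp (- s) ^ Z.abs_nat k);
    [lra| |now apply abs_summable_geom_Z].
  intros k; rewrite Rmult_1_l, !Rabs_pos_eq.
  - now apply gauss_le_geom_int.
  - apply pow_le; lra.
  - left; apply gauss_pos.
Qed.

Lemma abs_summable_gauss_half s : 0 < s -> abs_summable (fun k : Z => gauss s (IZR k + / 2)).
Proof.
  intros Hs; pose proof (exp_opp_bounds s Hs).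
  apply abs_summable_dom with (exp (s * 1)) (fun k : Z => exp (- s) ^ Z.abs_nat k);
    [left; apply exp_pos| |now apply abs_summable_geom_Z].
  intros k; rewrite !Rabs_pos_eq.
  - now apply gauss_le_geom_half.
  - apply pow_le; lra.
  - left; apply gauss_pos.
Qed.

Lemma abs_summable_bounded_mult {A} (b g : A -> R) : (forall a, Rabs (b a) <= 1) ->
  abs_summable g -> abs_summable (fun a => b a * g a).
Proof.
  intros Hb; apply abs_summable_dom with 1; [lra|]; intros a.
  rewrite Rabs_mult; apply Rmult_le_compat_r; [apply Rabs_pos|easy].
Qed.

Lemma has_sum_th3 s : 0 < s -> has_sum (fun k : Z => gauss s (IZR k)) (th3 s).
Proof.
  intros Hs; destruct (abs_summable_has_sum _ (abs_summable_gauss s Hs)) as [w Hw].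
  unfold th3, theta3; erewrite has_sum_Zsum; [exact Hw|].
  eapply has_sum_ext; [|exact Hw]; intros k; cbv beta.
  rewrite powerRZ_exp, mult_IZR; unfold gauss; f_equal; ring.
Qed.

Lemma has_sum_th2 s : 0 < s -> has_sum (fun k : Z => gauss s (IZR k + / 2)) (th2 s).
Proof.
  intros Hs; destruct (abs_summable_has_sum _ (abs_summable_gauss_half s Hs)) as [w Hw].
  unfold th2, theta2; erewrite has_sum_Zsum; [exact Hw|].
  eapply has_sum_ext; [|exact Hw]; intros k; cbv beta.
  unfold Rpower; rewrite ln_exp; unfold gauss; f_equal; ring.
Qed.

Lemma abs_summable_sg_gauss s : 0 < s -> abs_summable (fun k : Z => sg k * gauss s (IZR k)).
Proof.
  intros Hs; apply abs_summable_bounded_mult; [|now apply abs_summable_gauss].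
  intros; rewrite Rabs_sg; lra.
Qed.

Lemma has_sum_th4 s : 0 < s -> has_sum (fun k : Z => sg k * gauss s (IZR k)) (th4 s).
Proof.
  intros Hs; destruct (abs_summable_has_sum _ (abs_summable_sg_gauss s Hs)) as [w Hw].
  unfold th4, theta4; erewrite has_sum_Zsum; [exact Hw|].
  eapply has_sum_ext; [|exact Hw]; intros k; cbv beta.
  rewrite powerRZ_exp, mult_IZR; unfold gauss, sg; do 2 f_equal; ring.
Qed.

(* [Z * Z] splits into the pairs with even and with odd difference, each a copy of [Z * Z]. *)
Definition rot (p : Z * Z + Z * Z) : Z * Z :=
  match p with
  | inl (e, m) => (m - e, m + e)%Z
  | inr (e, m) => (m - e, m + e + 1)%Z
  end.

Definition rot_inv (p : Z * Z) : Z * Z + Z * Z :=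
  let d := (snd p - fst p)%Z in
  let e := (d / 2)%Z in
  if Z.even d then inl (e, fst p + e)%Z else inr (e, fst p + e)%Z.

Lemma rot_invK p : rot_inv (rot p) = p.
Proof.
  destruct p as [[e m]|[e m]]; unfold rot_inv, rot; cbv zeta; cbn [fst snd].
  - replace (m + e - (m - e))%Z with (e * 2)%Z by lia.
    replace (Z.even (e * 2)) with true by (rewrite Z.even_mul; apply eq_sym, Bool.orb_true_r).
    rewrite Z.div_mul by lia; do 2 apply f_equal; lia.
  - replace (m + e + 1 - (m - e))%Z with (1 + 2 * e)%Z by lia.
    rewrite Z.even_add_mul_2, (Z.mul_comm 2 e), Z.div_add by lia; cbn [Z.even].
    replace (1 / 2 + e)%Z with e by (change (1 / 2)%Z with 0%Z; lia).
    do 2 apply f_equal; lia.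
Qed.

Lemma rotK p : rot (rot_inv p) = p.
Proof.
  destruct p as [a b]; unfold rot_inv; simpl fst; simpl snd.
  pose proof (Z.div_mod (b - a) 2 ltac:(lia)) as H.
  rewrite Zmod_even in H.
  destruct (Z.even (b - a)); unfold rot; f_equal; lia.
Qed.

(** The common source of the duplication formulas: [U] collects the pairs with even difference and
    [V] those with odd difference. *)
Lemma has_sum_rot (f g : Z -> R) S T U V :
  abs_summable f -> abs_summable g -> has_sum f S -> has_sum g T ->
  has_sum (fun p : Z * Z => f (snd p - fst p)%Z * g (snd p + fst p)%Z) U ->
  has_sum (fun p : Z * Z => f (snd p - fst p)%Z * g (snd p + fst p + 1)%Z) V ->
  S * T = U + V.
Proof.
  intros Af Ag Hf Hg HU HV.
  apply (has_sum_unique (fun p => f (fst (rot p)) * g (snd (rot p)))).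
  - apply (has_sum_reindex rot rot_inv (fun p => f (fst p) * g (snd p)) _ rot_invK rotK).
    now apply has_sum_prod.
  - apply has_sum_sum_type.
    + eapply has_sum_ext; [|exact HU]; now intros [e m].
    + eapply has_sum_ext; [|exact HV]; now intros [e m].
Qed.

(** The parallelogram law (b - a)^2 + (b + a)^2 = 2 a^2 + 2 b^2 turns the rotated product back into
    a product, at the squared nome. *)
Lemma gauss_rot s a b : gauss s (b - a) * gauss s (b + a) = gauss (2 * s) a * gauss (2 * s) b.
Proof. unfold gauss; rewrite <- !exp_plus; f_equal; ring. Qed.

Lemma th3_sqr s : 0 < s -> th3 s * th3 s = th3 (2 * s) * th3 (2 * s) + th2 (2 * s) * th2 (2 * s).
Proof.
  intros Hs; assert (H2 : 0 < 2 * s) by lra.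
  eapply has_sum_rot; try apply (has_sum_th3 s Hs); try apply (abs_summable_gauss s Hs).
  - eapply has_sum_ext; [|apply has_sum_prod; try apply (has_sum_th3 _ H2);
      apply (abs_summable_gauss _ H2)].
    intros [e m]; simpl; rewrite minus_IZR, plus_IZR; symmetry; apply gauss_rot.
  (* The odd class consists of (m + 1/2) - (e + 1/2) and (m + 1/2) + (e + 1/2), hence two theta2
     series. *)
  - eapply has_sum_ext; [|apply has_sum_prod; try apply (has_sum_th2 _ H2);
      apply (abs_summable_gauss_half _ H2)].
    intros [e m]; simpl; rewrite minus_IZR, !plus_IZR, <- gauss_rot; f_equal; f_equal; lra.
Qed.

(** The two signs multiply to the sign of the sum of the indices, 2 m on the even class and 2 m + 1
    on the odd one; so only the theta2 part of [th3_sqr] changes sign. *)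
Lemma th4_sqr s : 0 < s -> th4 s * th4 s = th3 (2 * s) * th3 (2 * s) - th2 (2 * s) * th2 (2 * s).
Proof.
  intros Hs; assert (H2 : 0 < 2 * s) by lra.
  replace (th3 (2 * s) * th3 (2 * s) - th2 (2 * s) * th2 (2 * s)) with
    (th3 (2 * s) * th3 (2 * s) + -1 * (th2 (2 * s) * th2 (2 * s))) by ring.
  eapply has_sum_rot; try apply (has_sum_th4 s Hs); try apply (abs_summable_sg_gauss s Hs).
  - eapply has_sum_ext; [|apply has_sum_prod; try apply (has_sum_th3 _ H2);
      apply (abs_summable_gauss _ H2)].
    intros [e m]; simpl; rewrite minus_IZR, plus_IZR.
    rewrite <- gauss_rot.
    transitivity (sg ((m - e) + (m + e)) * (gauss s (IZR m - IZR e) * gauss s (IZR m + IZR e))).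
    + replace (m - e + (m + e))%Z with (2 * m)%Z by lia; rewrite sg_even; ring.
    + rewrite sg_add; ring.
  - eapply has_sum_ext; [|apply has_sum_scal, has_sum_prod; try apply (has_sum_th2 _ H2);
      apply (abs_summable_gauss_half _ H2)].
    intros [e m]; simpl; rewrite minus_IZR, !plus_IZR, <- gauss_rot.
    transitivity (sg ((m - e) + (m + e + 1)) * (gauss s (IZR m - IZR e) * gauss s (IZR m + IZR e + 1))).
    + replace (m - e + (m + e + 1))%Z with (2 * m + 1)%Z by lia; rewrite sg_add, sg_even, sg_1.
      replace (IZR m + / 2 - (IZR e + / 2)) with (IZR m - IZR e) by ring.
      replace (IZR m + / 2 + (IZR e + / 2)) with (IZR m + IZR e + 1) by field; ring.
    + rewrite sg_add; ring.
Qed.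

(** The reflection k -> -1 - k sends k + 1/2 to its negative and reverses the sign, so the sum
    equals its own opposite. *)
Lemma has_sum_sg_gauss_half s : 0 < s -> has_sum (fun k : Z => sg k * gauss s (IZR k + / 2)) 0.
Proof.
  intros Hs.
  assert (Ha : abs_summable (fun k : Z => sg k * gauss s (IZR k + / 2))).
  { apply abs_summable_bounded_mult; [|now apply abs_summable_gauss_half].
    intros; rewrite Rabs_sg; lra. }
  destruct (abs_summable_has_sum _ Ha) as [w Hw].
  assert (Hw' : has_sum (fun k : Z => sg k * gauss s (IZR k + / 2)) (-1 * w)).
  { apply has_sum_ext with
      (fun k : Z => -1 * (sg (-1 - k) * gauss s (IZR (-1 - k) + / 2))).
    - intros k; rewrite minus_IZR.
      replace (-1 - IZR k + / 2) with (- (IZR k + / 2)) by field.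
      rewrite gauss_opp, <- Rmult_assoc; f_equal.
      assert (E : sg 1 * sg (-1 - k) * sg k = 1).
      { rewrite <- !sg_add, <- (sg_even 0); apply f_equal; lia. }
      transitivity (sg 1 * sg (-1 - k) * (sg k * sg k)); [rewrite sg_sqr, sg_1; ring|].
      rewrite <- Rmult_assoc, E; ring.
    - apply has_sum_scal.
      apply (has_sum_reindex (fun k => -1 - k)%Z (fun k => -1 - k)%Z
               (fun k : Z => sg k * gauss s (IZR k + / 2))); [intros; lia|intros; lia|easy]. }
  pose proof (has_sum_unique _ _ _ Hw Hw') as E.
  replace 0 with w by lra; easy.
Qed.

(** Only the second factor carries a sign, which is that of m + e on the even class and splits into
    two theta4 series. The odd class is a multiple of the square of the vanishing sum
    [has_sum_sg_gauss_half]. *)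
Lemma th3_th4 s : 0 < s -> th3 s * th4 s = th4 (2 * s) * th4 (2 * s).
Proof.
  intros Hs; assert (H2 : 0 < 2 * s) by lra.
  replace (th4 (2 * s) * th4 (2 * s)) with (th4 (2 * s) * th4 (2 * s) + -1 * (0 * 0)) by ring.
  eapply has_sum_rot; [apply (abs_summable_gauss s Hs)|apply (abs_summable_sg_gauss s Hs)
    |apply (has_sum_th3 s Hs)|apply (has_sum_th4 s Hs)| |].
  - eapply has_sum_ext; [|apply has_sum_prod; try apply (has_sum_th4 _ H2);
      apply (abs_summable_sg_gauss _ H2)].
    intros [e m]; simpl; rewrite minus_IZR, plus_IZR, sg_add.
    transitivity (sg m * sg e * (gauss s (IZR m - IZR e) * gauss s (IZR m + IZR e)));
      [rewrite gauss_rot|]; ring.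
  - assert (Ha : abs_summable (fun k : Z => sg k * gauss (2 * s) (IZR k + / 2))).
    { apply abs_summable_bounded_mult; [|now apply abs_summable_gauss_half].
      intros; rewrite Rabs_sg; lra. }
    eapply has_sum_ext; [|apply has_sum_scal, has_sum_prod;
      try apply (has_sum_sg_gauss_half _ H2); exact Ha].
    intros [e m]; simpl; rewrite minus_IZR, !plus_IZR, !sg_add, sg_1.
    transitivity (- (sg m * sg e) * (gauss s (IZR m + / 2 - (IZR e + / 2)) * gauss s (IZR m + / 2 + (IZR e + / 2))));
      [rewrite gauss_rot; ring|].
    replace (IZR m + / 2 - (IZR e + / 2)) with (IZR m - IZR e) by ring.
    replace (IZR m + / 2 + (IZR e + / 2)) with (IZR m + IZR e + 1) by field; ring.
Qed.

Lemma th2_sqr s : 0 < s -> th2 s * th2 s = 2 * (th2 (2 * s) * th3 (2 * s)).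
Proof.
  intros Hs; assert (H2 : 0 < 2 * s) by lra.
  replace (2 * (th2 (2 * s) * th3 (2 * s))) with
    (th3 (2 * s) * th2 (2 * s) + th2 (2 * s) * th3 (2 * s)) by ring.
  eapply has_sum_rot; try apply (has_sum_th2 s Hs); try apply (abs_summable_gauss_half s Hs).
  - eapply has_sum_ext; [|apply has_sum_prod;
      [apply (abs_summable_gauss _ H2)|apply (abs_summable_gauss_half _ H2)
      |apply (has_sum_th3 _ H2)|apply (has_sum_th2 _ H2)]].
    intros [e m]; simpl; rewrite minus_IZR, plus_IZR, <- gauss_rot; f_equal; f_equal; lra.
  (* The half-integers m - e + 1/2 and m + e + 3/2 of the odd class are (m + 1) - (e + 1/2) and (m +
     1) + (e + 1/2); hence a theta3 series shifted by 1. *)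
  - assert (Hsh : has_sum (fun k : Z => gauss (2 * s) (IZR k + 1)) (th3 (2 * s))).
    { eapply has_sum_ext; [|apply (has_sum_reindex (fun k => k + 1)%Z (fun k => k - 1)%Z
         (fun k => gauss (2 * s) (IZR k))); [intros; lia|intros; lia|now apply has_sum_th3]].
      intros k; cbv beta; now rewrite plus_IZR. }
    assert (Ha : abs_summable (fun k : Z => gauss (2 * s) (IZR k + 1))).
    { destruct (abs_summable_reindex (fun k => k + 1)%Z (fun k => gauss (2 * s) (IZR k))
        (fun a b => proj1 (Z.add_cancel_r a b 1)) (abs_summable_gauss _ H2)) as [M HM].
      exists M; intros L Hn; eapply Rle_trans; [right|exact (HM L Hn)].
      apply lsum_ext; intros; now rewrite plus_IZR. }
    eapply has_sum_ext; [|apply has_sum_prod;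
      [apply (abs_summable_gauss_half _ H2)|exact Ha
      |apply (has_sum_th2 _ H2)|exact Hsh]].
    intros [e m]; simpl; rewrite minus_IZR, !plus_IZR, <- gauss_rot; f_equal; f_equal; lra.
Qed.

(** With a = theta3 and b = theta2 at the squared nome, this is (a^2 + b^2)^2 = (2 a b)^2 + (a^2 -
    b^2)^2. *)
Lemma jacobi_quartic s : 0 < s -> th3 s ^ 4 = th2 s ^ 4 + th4 s ^ 4.
Proof.
  intros Hs; pose proof (th3_sqr s Hs); pose proof (th4_sqr s Hs); pose proof (th2_sqr s Hs).
  replace (th3 s ^ 4) with ((th3 s * th3 s) * (th3 s * th3 s)) by ring.
  replace (th2 s ^ 4) with ((th2 s * th2 s) * (th2 s * th2 s)) by ring.
  replace (th4 s ^ 4) with ((th4 s * th4 s) * (th4 s * th4 s)) by ring.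
  rewrite H, H0, H1; ring.
Qed.

(** * Size of the theta-nulls *)

Lemma th3_bounds s : 0 < s -> 1 <= th3 s <= (1 + exp (- s)) / (1 - exp (- s)).
Proof.
  intros Hs; pose proof (exp_opp_bounds s Hs); split.
  - replace 1 with (lsum (fun k : Z => gauss s (IZR k)) [0%Z]).
    + apply has_sum_lsum_le; [intros; left; apply gauss_pos|now apply has_sum_th3|].
      repeat constructor; easy.
    + simpl; unfold gauss; replace (- (s * 0 ^ 2)) with 0 by ring; rewrite exp_0; ring.
  - eapply has_sum_le_bound; [now apply has_sum_th3|]; intros L Hn.
    eapply Rle_trans; [apply lsum_le; intros k; now apply gauss_le_geom_int|].
    now apply lsum_geom_Z.
Qed.

Lemma th2_bounds s : 0 < s ->
  gauss s (/ 2) <= th2 s <= gauss s (/ 2) * (2 * ((1 + exp (- s)) / (1 - exp (- s)))).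
Proof.
  intros Hs; pose proof (exp_opp_bounds s Hs); split.
  - replace (gauss s (/ 2)) with (lsum (fun k : Z => gauss s (IZR k + / 2)) [0%Z]).
    + apply has_sum_lsum_le; [intros; left; apply gauss_pos|now apply has_sum_th2|].
      repeat constructor; easy.
    + simpl; rewrite Rplus_0_l; ring.
  - eapply has_sum_le_bound; [now apply has_sum_th2|]; intros L Hn.
    set (rho := exp (- s)) in *.
    apply Rle_trans with (lsum (fun k : Z => gauss s (/ 2) *
      (rho ^ Z.abs_nat k + rho ^ Z.abs_nat (k + 1))) L).
    + apply lsum_le; intros k.
      replace (gauss s (IZR k + / 2)) with (gauss s (/ 2) * exp (- s * IZR (k * k + k)))
        by (unfold gauss; rewrite <- exp_plus, plus_IZR, mult_IZR; f_equal; field).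
      apply Rmult_le_compat_l; [left; apply gauss_pos|].
      (* The exponent k^2 + k is invariant under k -> -(k + 1), so [j] can be the nonnegative one of
         the two, and then j <= j^2 + j. Bounding by the sum of both powers makes the estimate
         uniform in k and produces the factor 2. *)
      assert (Hj : forall j, (0 <= j)%Z -> (k * k + k = j * j + j)%Z ->
        exp (- s * IZR (k * k + k)) <= rho ^ Z.abs_nat j).
      { intros j Hj E; rewrite E; unfold rho; rewrite exp_pow_nat, INR_IZR_INZ, Zabs2Nat.id_abs.
        rewrite Z.abs_eq by easy.
        assert (IZR j <= IZR (j * j + j)) by (apply IZR_le; nia).
        destruct (Req_dec (IZR j) (IZR (j * j + j))) as [->|]; [lra|].
        left; apply exp_increasing; nra. }
      assert (forall n, 0 <= rho ^ n) by (intros; apply pow_le; lra).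
      destruct (Z_le_gt_dec 0 k).
      * specialize (Hj k); specialize (H0 (Z.abs_nat (k + 1))).
        assert (exp (- s * IZR (k * k + k)) <= rho ^ Z.abs_nat k) by (apply Hj; lia). lra.
      * specialize (Hj (- (k + 1))%Z); specialize (H0 (Z.abs_nat k)).
        replace (Z.abs_nat (k + 1)) with (Z.abs_nat (- (k + 1))) by lia.
        assert (exp (- s * IZR (k * k + k)) <= rho ^ Z.abs_nat (- (k + 1))) by (apply Hj; lia). lra.
    + rewrite lsum_scal, lsum_plus.
      apply Rmult_le_compat_l; [left; apply gauss_pos|].
      pose proof (lsum_geom_Z rho L H Hn).
      assert (Hn' : NoDup (map (fun k => k + 1)%Z L)).
      { apply NoDup_map_NoDup_ForallPairs; [|easy]; intros a b _ _; lia. }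
      pose proof (lsum_geom_Z rho _ H Hn') as H1; rewrite lsum_map in H1. lra.
Qed.

(** * The finite triple product and the minimum of the theta function *)

(* [1 / (Q; Q)_n]; the extension by 0 to negative [n] keeps [(1 - Q^n) u_n = u_(n-1)] on [Z]. *)
Fixpoint qfact_inv (Q : R) (n : nat) : R :=
  match n with
  | O => 1
  | S m => qfact_inv Q m / (1 - Q ^ S m)
  end.

Definition qfact_invZ (Q : R) (k : Z) : R :=
  if Z_lt_dec k 0 then 0 else qfact_inv Q (Z.to_nat k).

Lemma pow_S_lt_1 Q n : 0 < Q < 1 -> 0 < Q ^ S n < 1.
Proof.
  intros HQ; split; [apply pow_lt; lra|].
  apply pow_lt_1_compat; [lra|lia].
Qed.

Lemma qfact_inv_ge1 Q n : 0 < Q < 1 -> 1 <= qfact_inv Q n.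
Proof.
  intros HQ; induction n as [|n IH]; [simpl; lra|].
  change (qfact_inv Q (S n)) with (qfact_inv Q n / (1 - Q ^ S n)).
  pose proof (pow_S_lt_1 Q n HQ).
  apply Rmult_le_reg_r with (1 - Q ^ S n); [lra|].
  unfold Rdiv; rewrite Rmult_assoc, Rinv_l by lra; lra.
Qed.

Lemma qfact_inv_growing Q : 0 < Q < 1 -> Un_growing (qfact_inv Q).
Proof.
  intros HQ n.
  change (qfact_inv Q (S n)) with (qfact_inv Q n / (1 - Q ^ S n)).
  pose proof (pow_S_lt_1 Q n HQ); pose proof (qfact_inv_ge1 Q n HQ).
  apply Rmult_le_reg_r with (1 - Q ^ S n); [lra|].
  unfold Rdiv; rewrite Rmult_assoc, Rinv_l by lra; nra.
Qed.

(** For y = Q^j with j >= 1, 1 / (1 - y) <= 1 + y / (1 - Q) <= exp (y / (1 - Q)); the exponent in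
    the statement is the geometric sum of these for j = 1, ..., n. *)
Lemma qfact_inv_bound Q n : 0 < Q < 1 ->
  qfact_inv Q n <= exp ((Q - Q ^ S n) / (1 - Q) ^ 2).
Proof.
  intros HQ; induction n as [|n IH].
  - simpl; replace ((Q - Q * 1) / _) with 0 by (field; lra); rewrite exp_0; lra.
  - change (qfact_inv Q (S n)) with (qfact_inv Q n / (1 - Q ^ S n)).
    set (y := Q ^ S n) in *.
    assert (Hy : 0 < y < 1) by now apply pow_S_lt_1.
    assert (HyQ : y <= Q).
    { unfold y; simpl; assert (Q ^ n <= 1 ^ n) by (apply pow_incr; lra).
      rewrite pow1 in H; nra. }
    replace (Q ^ S (S n)) with (Q * y) by reflexivity.
    replace ((Q - Q * y) / (1 - Q) ^ 2) with ((Q - y) / (1 - Q) ^ 2 + y / (1 - Q))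
      by (field; lra).
    rewrite exp_plus; apply Rmult_le_compat; [pose proof (qfact_inv_ge1 Q n HQ); lra| |easy|].
    + left; apply Rinv_0_lt_compat; lra.
    + assert (/ (1 - y) = 1 + y / (1 - y)) by (field; lra).
      assert (y / (1 - y) <= y / (1 - Q)).
      { apply Rmult_le_compat_l; [lra|]; apply Rinv_le_contravar; lra. }
      pose proof (exp_ineq1_le (y / (1 - Q))); lra.
Qed.

Lemma qfact_inv_cv Q : 0 < Q < 1 -> exists U, 1 <= U /\ Un_cv (qfact_inv Q) U /\
  forall n, qfact_inv Q n <= U.
Proof.
  intros HQ.
  destruct (growing_cv (qfact_inv Q)) as [U HU]; [now apply qfact_inv_growing| |].
  - exists (exp (Q / (1 - Q) ^ 2)); intros x [n ->].
    eapply Rle_trans; [now apply qfact_inv_bound|].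
    assert ((Q - Q ^ S n) / (1 - Q) ^ 2 <= Q / (1 - Q) ^ 2).
    { apply Rmult_le_compat_r; [left; apply Rinv_0_lt_compat; nra|].
      pose proof (pow_S_lt_1 Q n HQ); lra. }
    destruct H as [H| ->]; [left; now apply exp_increasing|lra].
  - assert (Hle : forall n, qfact_inv Q n <= U)
      by (intros n; apply growing_ineq; [now apply qfact_inv_growing|easy]).
    exists U; split; [|split; easy]. exact (Hle 0%nat).
Qed.

Lemma qfact_invZ_pred Q k : 0 < Q < 1 ->
  (1 - powerRZ Q k) * qfact_invZ Q k = qfact_invZ Q (k - 1).
Proof.
  intros HQ; unfold qfact_invZ.
  destruct (Z_lt_dec k 0), (Z_lt_dec (k - 1) 0); try lia; try ring.
  (* At k = 0 the factor 1 - Q^0 vanishes, in agreement with the value 0 at -1. *)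
  - replace k with 0%Z by lia; simpl; ring.
  - replace k with (Z.of_nat (S (Z.to_nat (k - 1)))) at 1 2 by lia.
    rewrite Nat2Z.id, <- pow_powerRZ.
    change (qfact_inv Q (S (Z.to_nat (k - 1)))) with
      (qfact_inv Q (Z.to_nat (k - 1)) / (1 - Q ^ S (Z.to_nat (k - 1)))).
    pose proof (pow_S_lt_1 Q (Z.to_nat (k - 1)) HQ); field; lra.
Qed.

(* With [q = exp (- s)], the coefficient of [z^k] in [prod_(j <= N) (1 + q^(2j-1) z) (1 + q^(2j-1) / z)],
   up to a positive factor depending on [N] only. *)
Definition jtp_coef (s : R) (N : nat) (k : Z) : R :=
  gauss s (IZR k) * (qfact_invZ (exp (- (2 * s))) (Z.of_nat N - k) *
                     qfact_invZ (exp (- (2 * s))) (Z.of_nat N + k)).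

(** Multiplication by the next factor (1 + q^(2N+1) z) (1 + q^(2N+1) / z), read off at z^k. The true
    coefficient is (Q; Q)_(2N) times [jtp_coef], with Q = q^2, whence the two factors 1 - Q^(2N+1)
    and 1 - Q^(2N+2) on the left. *)
Lemma jtp_coef_rec s N k : 0 < s ->
  (1 - exp (- (2 * s)) ^ (2 * N + 1)) * (1 - exp (- (2 * s)) ^ (2 * N + 2)) * jtp_coef s (S N) k =
  (1 + exp (- (2 * s)) ^ (2 * N + 1)) * jtp_coef s N k +
  exp (- s) ^ (2 * N + 1) * (jtp_coef s N (k - 1) + jtp_coef s N (k + 1)).
Proof.
  intros Hs; unfold jtp_coef.
  assert (HQ : 0 < exp (- (2 * s)) < 1) by (apply exp_opp_bounds; lra).
  set (Q := exp (- (2 * s))) in *; set (n := Z.of_nat N).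
  replace (Z.of_nat (S N) - k)%Z with (n - k + 1)%Z by lia.
  replace (Z.of_nat (S N) + k)%Z with (n + k + 1)%Z by lia.
  replace (n - (k - 1))%Z with (n - k + 1)%Z by lia.
  replace (n + (k - 1))%Z with (n + k - 1)%Z by lia.
  replace (n - (k + 1))%Z with (n - k - 1)%Z by lia.
  replace (n + (k + 1))%Z with (n + k + 1)%Z by lia.
  assert (pQ : forall j, powerRZ Q j = exp (- (2 * s) * IZR j)) by (intros; apply powerRZ_exp).
  assert (EA := qfact_invZ_pred Q (n - k + 1) HQ).
  assert (EB := qfact_invZ_pred Q (n + k + 1) HQ).
  assert (EX := qfact_invZ_pred Q (n - k) HQ).
  assert (EY := qfact_invZ_pred Q (n + k) HQ).
  replace (n - k + 1 - 1)%Z with (n - k)%Z in EA by lia.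
  replace (n + k + 1 - 1)%Z with (n + k)%Z in EB by lia.
  (* Every reciprocal factorial is expressed by the two of largest index, [A] and [B], so that a
     polynomial identity in A, B, X, Y remains. *)
  rewrite <- EX, <- EY, <- EA, <- EB; clear EX EY EA EB.
  set (A := qfact_invZ Q (n - k + 1)); set (B := qfact_invZ Q (n + k + 1)).
  rewrite (powerRZ_add Q (n - k) 1), (powerRZ_add Q (n + k) 1) by lra; rewrite !powerRZ_1.
  replace (Q ^ (2 * N + 1)) with (Q * (powerRZ Q (n - k) * powerRZ Q (n + k))).
  2:{ rewrite <- powerRZ_add by lra; replace (n - k + (n + k))%Z with (Z.of_nat (2 * N)) by lia.
      rewrite <- pow_powerRZ, pow_add; ring. }
  replace (Q ^ (2 * N + 2)) with (Q * Q * (powerRZ Q (n - k) * powerRZ Q (n + k))).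
  2:{ rewrite <- powerRZ_add by lra; replace (n - k + (n + k))%Z with (Z.of_nat (2 * N)) by lia.
      rewrite <- pow_powerRZ, pow_add; ring. }
  (* Completing the square: (2 N + 1) + (k - 1)^2 = k^2 + 2 (N - k + 1); likewise for k + 1 in
     [G2]. *)
  assert (G1 : exp (- s) ^ (2 * N + 1) * gauss s (IZR (k - 1)) =
               gauss s (IZR k) * (Q * powerRZ Q (n - k))).
  { rewrite pQ, exp_pow_nat; unfold gauss, Q, n; rewrite <- !exp_plus; f_equal.
    rewrite !minus_IZR, <- INR_IZR_INZ, plus_INR, mult_INR.
    change (INR 2) with 2; change (INR 1) with 1; ring. }
  assert (G2 : exp (- s) ^ (2 * N + 1) * gauss s (IZR (k + 1)) =
               gauss s (IZR k) * (Q * powerRZ Q (n + k))).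
  { rewrite pQ, exp_pow_nat; unfold gauss, Q, n; rewrite <- !exp_plus; f_equal.
    rewrite !plus_IZR, <- INR_IZR_INZ, plus_INR, mult_INR.
    change (INR 2) with 2; change (INR 1) with 1; ring. }
  set (X := powerRZ Q (n - k)) in *; set (Y := powerRZ Q (n + k)) in *.
  rewrite (Rmult_plus_distr_l (exp (- s) ^ (2 * N + 1))).
  rewrite <- !(Rmult_assoc (exp (- s) ^ (2 * N + 1))), G1, G2; ring.
Qed.

Lemma qfact_invZ_bounds Q U k : 0 < Q < 1 -> 1 <= U -> (forall n, qfact_inv Q n <= U) ->
  0 <= qfact_invZ Q k <= U.
Proof.
  intros HQ HU Hb; unfold qfact_invZ; destruct Z_lt_dec; [lra|].
  pose proof (qfact_inv_ge1 Q (Z.to_nat k) HQ); split; [lra|apply Hb].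
Qed.

Lemma qfact_invZ_cv Q U k : Un_cv (qfact_inv Q) U ->
  Un_cv (fun N => qfact_invZ Q (Z.of_nat N + k)) U.
Proof.
  intros H e He; destruct (H e He) as [N0 HN].
  exists (N0 + Z.abs_nat k)%nat; intros n Hn; unfold qfact_invZ.
  destruct Z_lt_dec; [lia|]; apply HN; lia.
Qed.

Lemma jtp_coef_bound s U N k : 0 < s -> 1 <= U ->
  (forall n, qfact_inv (exp (- (2 * s))) n <= U) ->
  0 <= jtp_coef s N k <= U * U * gauss s (IZR k).
Proof.
  intros Hs HU Hb; unfold jtp_coef.
  assert (HQ : 0 < exp (- (2 * s)) < 1) by (apply exp_opp_bounds; lra).
  pose proof (qfact_invZ_bounds _ U (Z.of_nat N - k) HQ HU Hb).
  pose proof (qfact_invZ_bounds _ U (Z.of_nat N + k) HQ HU Hb).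
  pose proof (gauss_pos s (IZR k)).
  set (x := qfact_invZ _ _) in *; set (y := qfact_invZ _ (Z.of_nat N + k)) in *.
  assert (0 <= x * y) by nra. assert (x * y <= U * U) by (apply Rmult_le_compat; lra).
  split; [nra|]. rewrite (Rmult_comm (U * U)); apply Rmult_le_compat_l; lra.
Qed.

(** The recurrence summed at z = exp (i phi), where the new factor is |1 + q^(2N+1) z|^2. *)
Lemma has_sum_jtp_step s N phi T : 0 < s ->
  has_sum (fun k => jtp_coef s N k * cos (phi * IZR k)) T ->
  has_sum (fun k => (1 - exp (- (2 * s)) ^ (2 * N + 1)) * (1 - exp (- (2 * s)) ^ (2 * N + 2)) *
                    (jtp_coef s (S N) k * cos (phi * IZR k)))
    ((1 + exp (- (2 * s)) ^ (2 * N + 1) + 2 * exp (- s) ^ (2 * N + 1) * cos phi) * T).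
Proof.
  intros Hs HT.
  assert (HQ : 0 < exp (- (2 * s)) < 1) by (apply exp_opp_bounds; lra).
  destruct (qfact_inv_cv _ HQ) as [U [HU [_ Hb]]].
  assert (Ha : abs_summable (jtp_coef s N)).
  { apply abs_summable_dom with (U * U) (fun k => gauss s (IZR k)); [nra| |now apply abs_summable_gauss].
    intros k; pose proof (jtp_coef_bound s U N k Hs HU Hb).
    rewrite !Rabs_pos_eq; [lra|left; apply gauss_pos|lra]. }
  assert (Hsh : forall d : Z, exists X,
     has_sum (fun k => jtp_coef s N k * cos (phi * IZR (k + d))) X /\
     has_sum (fun k => jtp_coef s N (k - d) * cos (phi * IZR k)) X).
  { intros d.
    assert (Hd : abs_summable (fun k => cos (phi * IZR (k + d)) * jtp_coef s N k)).
    { apply abs_summable_bounded_mult; [|easy]; intros k; apply Rabs_le, COS_bound. }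
    destruct (abs_summable_has_sum _ Hd) as [X HX]; exists X; split.
    - eapply has_sum_ext; [|exact HX]; intros k; cbv beta; ring.
    - eapply has_sum_ext; [|apply (has_sum_reindex (fun k => k - d)%Z (fun k => k + d)%Z (fun k => cos (phi * IZR (k + d)) * jtp_coef s N k) X); [| |exact HX]].
      + intros k; cbv beta. replace (k - d + d)%Z with k by lia; ring.
      + intros; lia.
      + intros; lia. }
  destruct (Hsh 1%Z) as [X [X1 X2]]; destruct (Hsh (-1)%Z) as [Y [Y1 Y2]].
  (* The shifted sums are not evaluated separately; by the addition formulas the sine parts cancel
     in X + Y. *)
  assert (E : X + Y = 2 * cos phi * T).
  { apply (has_sum_unique (fun k => jtp_coef s N k * cos (phi * IZR (k + 1)) +
                                    jtp_coef s N k * cos (phi * IZR (k + -1)))).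
    - now apply has_sum_plus.
    - eapply has_sum_ext; [|apply has_sum_scal, HT]; intros k; cbv beta.
      rewrite !plus_IZR.
      replace (phi * (IZR k + 1)) with (phi * IZR k + phi) by ring.
      replace (phi * (IZR k + -1)) with (phi * IZR k - phi) by ring.
      rewrite cos_plus, cos_minus; ring. }
  replace (_ * T) with ((1 + exp (- (2 * s)) ^ (2 * N + 1)) * T + exp (- s) ^ (2 * N + 1) * (X + Y))
    by (rewrite E; ring).
  eapply has_sum_ext; [|apply has_sum_plus; [apply has_sum_scal, HT|apply has_sum_scal, has_sum_plus;
     [exact X2|exact Y2]]].
  intros k; cbv beta.
  rewrite <- (Rmult_assoc _ (jtp_coef s (S N) k)), jtp_coef_rec by easy.
  replace (k - -1)%Z with (k + 1)%Z by lia; ring.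
Qed.

(** Induction over the factors: each satisfies 1 + z^2 + 2 z cos phi >= (1 - z)^2 >= 0 with equality
    on the left at phi = PI, and products of nonnegative inequalities can be multiplied. *)
Lemma jtp_sum_min s N phi : 0 < s -> exists T T0,
  has_sum (fun k => jtp_coef s N k * cos (phi * IZR k)) T /\
  has_sum (fun k => jtp_coef s N k * cos (PI * IZR k)) T0 /\ 0 <= T0 <= T.
Proof.
  intros Hs; induction N as [|N [T [T0 [HT [HT0 Hle]]]]].
  (* The empty product: for k <> 0 one of k, -k is negative and kills the coefficient, while the
     coefficient at k = 0 is 1. *)
  - assert (H : forall phi, has_sum (fun k => jtp_coef s 0 k * cos (phi * IZR k)) 1).
    { intros p e He; exists [0%Z]; intros L Hn Hi.
      replace (lsum _ L) with 1; [rewrite Rminus_diag, Rabs_R0; easy|].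
      destruct (in_split 0%Z L) as [L1 [L2 ->]]; [apply Hi; now left|].
      assert (Hz : forall l, ~ In 0%Z l -> lsum (fun k => jtp_coef s 0 k * cos (p * IZR k)) l = 0).
      { induction l as [|k l IH]; intros H0; [easy|]; simpl.
        rewrite IH by (intros H1; apply H0; now right).
        assert (k <> 0%Z) by (intros ->; apply H0; now left).
        unfold jtp_coef, qfact_invZ; repeat destruct Z_lt_dec; simpl in *; try lia; ring. }
      apply NoDup_remove_2 in Hn; rewrite in_app_iff in Hn.
      rewrite lsum_app; simpl; rewrite !Hz by tauto.
      unfold jtp_coef, qfact_invZ, gauss; repeat destruct Z_lt_dec; simpl in *; try lia.
      replace (- (s * (0 * (0 * 1)))) with 0 by ring; rewrite exp_0, Rmult_0_r, cos_0; ring. }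
    exists 1, 1; split; [apply H|split; [apply H|lra]].
  - set (c := (1 - exp (- (2 * s)) ^ (2 * N + 1)) * (1 - exp (- (2 * s)) ^ (2 * N + 2))).
    assert (HQ : 0 < exp (- (2 * s)) < 1) by (apply exp_opp_bounds; lra).
    assert (Hc : 0 < c).
    { unfold c; replace (2 * N + 1)%nat with (S (2 * N)) by lia.
      replace (2 * N + 2)%nat with (S (S (2 * N))) by lia.
      pose proof (pow_S_lt_1 _ (2 * N) HQ); pose proof (pow_S_lt_1 _ (S (2 * N)) HQ); nra. }
    pose proof (has_sum_jtp_step s N phi T Hs HT) as H1.
    pose proof (has_sum_jtp_step s N PI T0 Hs HT0) as H2.
    fold c in H1, H2; apply (has_sum_scal (/ c)) in H1; apply (has_sum_scal (/ c)) in H2.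
    eexists; eexists; split; [|split].
    + eapply has_sum_ext; [|exact H1]; intros k; cbv beta; field; lra.
    + eapply has_sum_ext; [|exact H2]; intros k; cbv beta; field; lra.
    + assert (Eq : exp (- (2 * s)) ^ (2 * N + 1) = (exp (- s) ^ (2 * N + 1)) ^ 2).
      { replace (exp (- (2 * s))) with (exp (- s) ^ 2) by
          (simpl; rewrite Rmult_1_r, <- exp_plus; f_equal; ring).
        rewrite <- !pow_mult; f_equal; lia. }
      rewrite Eq, cos_PI; set (z := exp (- s) ^ (2 * N + 1)).
      assert (0 < z) by (apply pow_lt, exp_pos).
      pose proof (COS_bound phi).
      assert (0 < / c) by now apply Rinv_0_lt_compat.
      assert (0 <= 1 + z ^ 2 + 2 * z * -1)
        by (replace (1 + z ^ 2 + 2 * z * -1) with ((1 - z) ^ 2) by ring; apply pow2_ge_0).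
      assert (1 + z ^ 2 + 2 * z * -1 <= 1 + z ^ 2 + 2 * z * cos phi) by nra.
      split.
      * apply Rmult_le_pos; [lra|]; apply Rmult_le_pos; lra.
      * apply Rmult_le_compat_l; [lra|]; apply Rmult_le_compat; lra.
Qed.

Lemma abs_summable_theta_char s phi : 0 < s ->
  abs_summable (fun k => cos (phi * IZR k) * gauss s (IZR k)).
Proof.
  intros Hs; apply abs_summable_bounded_mult; [|now apply abs_summable_gauss].
  intros k; apply Rabs_le, COS_bound.
Qed.

(** As N grows, both reciprocal factorials tend to [U] = 1 / (Q; Q)_infinity, so the coefficients
    tend to U^2 q^(k^2), under the summable bound U^2 [gauss]. *)
Lemma jtp_sum_cv s U phi T (TN : nat -> R) : 0 < s -> 1 <= U ->
  Un_cv (qfact_inv (exp (- (2 * s)))) U -> (forall n, qfact_inv (exp (- (2 * s))) n <= U) ->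
  has_sum (fun k => cos (phi * IZR k) * gauss s (IZR k)) T ->
  (forall N, has_sum (fun k => jtp_coef s N k * cos (phi * IZR k)) (TN N)) ->
  Un_cv TN (U * U * T).
Proof.
  intros Hs HU Hcv Hb HT HN.
  apply (tannery (fun N k => jtp_coef s N k * cos (phi * IZR k))
    (fun k => U * U * (cos (phi * IZR k) * gauss s (IZR k)))
    (fun k => U * U * gauss s (IZR k)) TN _ (U * U * th3 s)).
  - intros k.
    replace (U * U * (cos (phi * IZR k) * gauss s (IZR k))) with
      (gauss s (IZR k) * (U * U) * cos (phi * IZR k)) by ring.
    unfold jtp_coef.
    apply (CV_mult _ (fun _ => cos (phi * IZR k))).
    + apply (CV_mult (fun _ => gauss s (IZR k))).
      * intros e He; exists 0%nat; intros; rewrite Rdist_eq; easy.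
      * apply CV_mult; [|now apply qfact_invZ_cv]. now apply (qfact_invZ_cv _ _ (- k)).
    + intros e He; exists 0%nat; intros; rewrite Rdist_eq; easy.
  - intros N k; rewrite Rabs_mult.
    pose proof (jtp_coef_bound s U N k Hs HU Hb).
    assert (Rabs (cos (phi * IZR k)) <= 1) by apply Rabs_le, COS_bound.
    pose proof (Rabs_pos (cos (phi * IZR k))).
    rewrite (Rabs_pos_eq (jtp_coef s N k)) by lra; nra.
  - intros k; rewrite !Rabs_mult.
    assert (Rabs (cos (phi * IZR k)) <= 1) by apply Rabs_le, COS_bound.
    rewrite (Rabs_pos_eq U), (Rabs_pos_eq (gauss s (IZR k))) by (try lra; left; apply gauss_pos).
    pose proof (gauss_pos s (IZR k)).
    apply Rmult_le_compat_l; [nra|]; pose proof (Rabs_pos (cos (phi * IZR k))); nra.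
  - exact HN.
  - now apply has_sum_scal.
  - now apply has_sum_scal, has_sum_th3.
Qed.

Lemma Un_cv_le (u v : nat -> R) l m : (forall n, u n <= v n) -> Un_cv u l -> Un_cv v m -> l <= m.
Proof.
  intros H Hu Hv; apply Rnot_lt_le; intros Hlt.
  destruct (Hu ((l - m) / 2)) as [N1 H1]; [lra|].
  destruct (Hv ((l - m) / 2)) as [N2 H2]; [lra|].
  specialize (H1 (Nat.max N1 N2) ltac:(lia)); specialize (H2 (Nat.max N1 N2) ltac:(lia)).
  specialize (H (Nat.max N1 N2)).
  unfold Rdist in *; apply Rabs_def2 in H1; apply Rabs_def2 in H2; lra.
Qed.

Lemma theta_min s phi T : 0 < s ->
  has_sum (fun k => cos (phi * IZR k) * gauss s (IZR k)) T -> 0 <= th4 s <= T.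
Proof.
  intros Hs HT.
  assert (HQ : 0 < exp (- (2 * s)) < 1) by (apply exp_opp_bounds; lra).
  destruct (qfact_inv_cv _ HQ) as [U [HU [Hcv Hb]]].
  (* Two successive choices turn the sums given for each N into sequences [TN] and [SN] that can be
     passed to the limit. *)
  pose proof (fun N => constructive_indefinite_description _ (jtp_sum_min s N phi Hs)) as F.
  set (TN := fun N => proj1_sig (F N)).
  assert (HF : forall N, exists T0, has_sum (fun k => jtp_coef s N k * cos (phi * IZR k)) (TN N) /\
     has_sum (fun k => jtp_coef s N k * cos (PI * IZR k)) T0 /\ 0 <= T0 <= TN N)
    by (intros N; exact (proj2_sig (F N))).
  clearbody TN; clear F.
  pose proof (fun N => constructive_indefinite_description _ (HF N)) as F.
  set (SN := fun N => proj1_sig (F N)).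
  assert (HG : forall N, has_sum (fun k => jtp_coef s N k * cos (phi * IZR k)) (TN N) /\
     has_sum (fun k => jtp_coef s N k * cos (PI * IZR k)) (SN N) /\ 0 <= SN N <= TN N)
    by (intros N; exact (proj2_sig (F N))).
  clearbody SN.
  assert (C1 : Un_cv TN (U * U * T)) by (apply (jtp_sum_cv s U phi); auto; intros N; apply HG).
  assert (C2 : Un_cv SN (U * U * th4 s)).
  { apply (jtp_sum_cv s U PI); auto; [|intros N; apply HG].
    eapply has_sum_ext; [|apply has_sum_th4, Hs]; intros k; cbv beta; now rewrite cos_PI_IZR. }
  assert (K1 : U * U * th4 s <= U * U * T).
  { apply (Un_cv_le SN TN); auto; intros N; apply HG. }
  assert (K2 : 0 <= U * U * th4 s).
  { apply (Un_cv_le (fun _ => 0) SN); auto; [intros N; apply HG|].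
    intros e He; exists 0%nat; intros; rewrite Rdist_eq; easy. }
  assert (0 < U * U) by nra; split; nra.
Qed.

Lemma theta_max s phi T : 0 < s ->
  has_sum (fun k => cos (phi * IZR k) * gauss s (IZR k)) T -> T <= th3 s.
Proof.
  intros Hs HT; eapply has_sum_le_bound; [exact HT|]; intros L Hn.
  apply Rle_trans with (lsum (fun k => gauss s (IZR k)) L).
  - apply lsum_le; intros k; pose proof (gauss_pos s (IZR k)).
    pose proof (COS_bound (phi * IZR k)); nra.
  - apply has_sum_lsum_le; [intros; left; apply gauss_pos|now apply has_sum_th3|easy].
Qed.

(** * The hypergeometric function and the Landen transformation *)

(* [((1/2)_n / n!)^2]. *)
Fixpoint hc (n : nat) : R :=
  match n with
  | O => 1
  | S m => hc m * ((INR m + / 2) / (INR m + 1)) ^ 2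
  end.

Definition hypF (x : R) : R := PSeries hc x.
Definition hypF' (x : R) : R := PSeries (PS_derive hc) x.

Lemma hc_pos_le1 n : 0 < hc n <= 1.
Proof.
  induction n as [|n IH]; [simpl; lra|].
  change (hc (S n)) with (hc n * ((INR n + / 2) / (INR n + 1)) ^ 2).
  pose proof (pos_INR n).
  assert (0 < (INR n + / 2) / (INR n + 1)) by (apply Rdiv_lt_0_compat; lra).
  assert ((INR n + / 2) / (INR n + 1) <= 1).
  { apply Rmult_le_reg_r with (INR n + 1); [lra|].
    unfold Rdiv; rewrite Rmult_assoc, Rinv_l by lra; lra. }
  set (z := (INR n + / 2) / (INR n + 1)) in *.
  assert (0 < z ^ 2 <= 1) by (split; nra). split; nra.
Qed.

Lemma CV_radius_ge_1 a : (forall n, Rabs (a n) <= 1) -> Rbar_le 1 (CV_radius a).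
Proof.
  intros Ha; apply CV_radius_bounded.
  exists 1; intros n; rewrite pow1, Rmult_1_r; apply Ha.
Qed.

Lemma CV_hc x : Rabs x < 1 -> Rbar_lt (Rabs x) (CV_radius hc).
Proof.
  intros Hx; apply Rbar_lt_le_trans with 1; [easy|].
  apply CV_radius_ge_1; intros n; pose proof (hc_pos_le1 n).
  rewrite Rabs_pos_eq; lra.
Qed.

Lemma CV_hc1 x : Rabs x < 1 -> Rbar_lt (Rabs x) (CV_radius (PS_derive hc)).
Proof. intros; rewrite CV_radius_derive; now apply CV_hc. Qed.

Lemma CV_hc2 x : Rabs x < 1 -> Rbar_lt (Rabs x) (CV_radius (PS_derive (PS_derive hc))).
Proof. intros; rewrite CV_radius_derive; now apply CV_hc1. Qed.

Lemma poch_1 n : poch 1 n = INR (fact n).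
Proof.
  induction n as [|n IH]; [easy|].
  simpl poch; rewrite IH, fact_simpl, mult_INR, S_INR; ring.
Qed.

Lemma hyp2F1_hypF x : Rabs x < 1 -> hyp2F1 (1 / 2) (1 / 2) 1 x = hypF x.
Proof.
  intros Hx; unfold hyp2F1; apply lim_seq_unique.
  assert (Hs : is_series (fun n => hc n * x ^ n) (hypF x)).
  { apply Series_correct, ex_pseries_R, CV_radius_inside, CV_hc, Hx. }
  apply is_series_Reals in Hs.
  intros e He; destruct (Hs e He) as [N HN]; exists N; intros n Hn.
  rewrite (sum_eq _ (fun n => hc n * x ^ n)); [now apply HN|].
  intros i _.
  replace (poch (1 / 2) i * poch (1 / 2) i / poch 1 i) with (hc i * INR (fact i)).
  - field; apply INR_fact_neq_0.
  - rewrite poch_1; induction i as [|i IH]; [simpl; field|].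
    assert (INR (fact i) <> 0) by apply INR_fact_neq_0.
    assert (INR i + 1 <> 0) by (pose proof (pos_INR i); lra).
    change (hc (S i)) with (hc i * ((INR i + / 2) / (INR i + 1)) ^ 2).
    simpl poch; rewrite fact_simpl, mult_INR, S_INR.
    transitivity (hc i * INR (fact i) * (INR i + / 2) ^ 2 / (INR i + 1)); [field; easy|].
    rewrite IH; field; easy.
Qed.

Lemma hypF_derive x : Rabs x < 1 -> is_derive hypF x (hypF' x).
Proof. intros Hx; now apply is_derive_PSeries, CV_hc. Qed.

Lemma hypF'_derive x : Rabs x < 1 -> is_derive hypF' x (PSeries (PS_derive (PS_derive hc)) x).
Proof. intros Hx; now apply is_derive_PSeries, CV_hc1. Qed.

Lemma hypF_ode x : Rabs x < 1 ->
  x * (1 - x) * PSeries (PS_derive (PS_derive hc)) x + (1 - 2 * x) * hypF' x = hypF x / 4.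
Proof.
  intros Hx; unfold hypF, hypF'.
  (* The series of x F'' + F', whose n-th coefficient is (n + 1)^2 c_(n+1) = (n^2 + n + 1/4) c_n;
     the three terms of [E2] are n^2, n and 1/4 in this order. *)
  set (e := PS_plus (PS_incr_1 (PS_derive (PS_derive hc))) (PS_derive hc)).
  assert (X0 : ex_pseries hc x) by now apply CV_radius_inside, CV_hc.
  assert (X1 : ex_pseries (PS_derive hc) x) by now apply CV_radius_inside, CV_hc1.
  assert (X2 : ex_pseries (PS_derive (PS_derive hc)) x) by now apply CV_radius_inside, CV_hc2.
  assert (X3 : ex_pseries (PS_incr_1 (PS_derive (PS_derive hc))) x) by now apply ex_pseries_incr_1.
  assert (X4 : ex_pseries (PS_incr_1 (PS_derive hc)) x) by now apply ex_pseries_incr_1.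
  assert (Xe : ex_pseries e x) by now apply ex_pseries_plus.
  assert (E1 : PSeries e x = x * PSeries (PS_derive (PS_derive hc)) x + PSeries (PS_derive hc) x).
  { unfold e; rewrite PSeries_plus, PSeries_incr_1 by easy; easy. }
  assert (E2 : PSeries e x = x * PSeries e x + x * PSeries (PS_derive hc) x + / 4 * PSeries hc x).
  { transitivity (PSeries (PS_plus (PS_plus (PS_incr_1 e) (PS_incr_1 (PS_derive hc))) (PS_scal (/ 4) hc)) x).
    2:{ rewrite !PSeries_plus, !PSeries_incr_1, PSeries_scal; [easy| | | |].
        - now apply ex_pseries_incr_1.
        - easy.
        - apply ex_pseries_plus; [now apply ex_pseries_incr_1|easy].
        - apply ex_pseries_scal; [apply Rmult_comm|easy]. }
    assert (Ee : forall n, e n = (INR n + 1) ^ 2 * hc (S n)).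
    { intros [|n].
      - change (0 + INR 1 * hc 1 = (0 + 1) ^ 2 * hc 1); simpl INR; ring.
      - change (INR (S n) * (INR (S (S n)) * hc (S (S n))) + INR (S (S n)) * hc (S (S n)) =
                (INR (S n) + 1) ^ 2 * hc (S (S n))).
        rewrite !S_INR; ring. }
    assert (Hrec : forall n, (INR n + 1) ^ 2 * hc (S n) = hc n * (INR n + / 2) ^ 2).
    { intros n; pose proof (pos_INR n).
      change (hc (S n)) with (hc n * ((INR n + / 2) / (INR n + 1)) ^ 2); field; lra. }
    apply PSeries_ext; intros [|n]; rewrite Ee, Hrec.
    - change (hc 0 * (0 + / 2) ^ 2 = 0 + 0 + / 4 * hc 0); field.
    - change (hc (S n) * (INR (S n) + / 2) ^ 2 = e n + INR (S n) * hc (S n) + / 4 * hc (S n)).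
      rewrite Ee, S_INR; field. }
  nra.
Qed.

(* Self-adjoint form of the hypergeometric equation: [(x (1 - x) hypF')' = hypF / 4]. *)
Definition hypH (x : R) : R := x * (1 - x) * hypF' x.

Lemma hypH_derive x : Rabs x < 1 -> is_derive hypH x (hypF x / 4).
Proof.
  intros Hx; rewrite <- hypF_ode by easy; unfold hypH.
  pose proof (hypF'_derive x Hx) as HD.
  auto_derive; [now eexists; exact HD|].
  replace (Derive (fun x0 => hypF' x0) x) with (PSeries (PS_derive (PS_derive hc)) x)
    by (symmetry; now apply is_derive_unique). ring.
Qed.

Lemma PSeries_ge_head a x : (forall n, 0 <= a n) -> 0 <= x -> ex_pseries a x -> a O <= PSeries a x.
Proof.
  intros Ha Hx Hex.
  rewrite PSeries_decr_1 by easy.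
  assert (0 <= PSeries (PS_decr_1 a) x); [|nra].
  destruct (Req_dec x 0) as [->|Hne].
  - rewrite PSeries_0; apply Ha.
  - assert (Hs : 0 <= Series (fun n => PS_decr_1 a n * x ^ n)); [|exact Hs].
    rewrite <- (Rmult_0_l (Series (fun n => PS_decr_1 a n * x ^ n))), <- Series_scal_l.
    apply Series_le.
    + intros n; assert (0 <= PS_decr_1 a n * x ^ n); [|lra].
      apply Rmult_le_pos; [apply Ha|now apply pow_le].
    + apply (proj1 (ex_pseries_R _ _)), ex_pseries_decr_1; [|easy].
      right; exists (/ x); now apply Rinv_l.
Qed.

Lemma hypF_ge_1 x : 0 <= x < 1 -> 1 <= hypF x.
Proof.
  intros Hx; apply (PSeries_ge_head hc); [intros n; pose proof (hc_pos_le1 n); lra|lra|].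
  apply CV_radius_inside, CV_hc; rewrite Rabs_pos_eq; lra.
Qed.

Lemma hypF'_ge x : 0 <= x < 1 -> / 4 <= hypF' x.
Proof.
  intros Hx.
  replace (/ 4) with (PS_derive hc 0) by (unfold PS_derive; simpl; field).
  apply (PSeries_ge_head (PS_derive hc)); [|lra|].
  - intros n; unfold PS_derive; pose proof (hc_pos_le1 (S n)); pose proof (pos_INR (S n)); nra.
  - apply CV_radius_inside, CV_hc1; rewrite Rabs_pos_eq; lra.
Qed.

Lemma hypF_0 : hypF 0 = 1.
Proof. apply PSeries_0. Qed.

Lemma hypF_increasing x y : 0 <= x -> x < y -> y < 1 -> hypF x < hypF y.
Proof.
  intros Hx Hxy Hy.
  destruct (MVT_gen hypF x y hypF') as [c [Hc E]];
    rewrite ?Rmin_left, ?Rmax_right in * by lra.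
  - intros t Ht; apply hypF_derive, Rabs_def1; lra.
  - intros t Ht; apply derivable_continuous_pt; exists (hypF' t).
    apply is_derive_Reals, hypF_derive, Rabs_def1; lra.
  - assert (/ 4 <= hypF' c) by (apply hypF'_ge; lra). nra.
Qed.

(* Both sides solve the same second-order equation and are regular at 0, so their (weighted)
   Wronskian [W] is constant, equal to [W 0 = 0], and their quotient is constant. *)
Lemma landen x : 0 <= x < 1 -> hypF (4 * x / (1 + x) ^ 2) = (1 + x) * hypF (x ^ 2).
Proof.
  intros Hx.
  destruct (Req_dec x 0) as [->|Hne].
  { replace (4 * 0 / _) with 0 by field; replace (0 ^ 2) with 0 by ring; ring. }
  set (m := fun t => 4 * t / (1 + t) ^ 2).
  assert (Hm : forall t, 0 <= t < 1 -> 0 <= m t < 1).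
  { intros t Ht; unfold m; split.
    - apply Rmult_le_pos; [lra|left; apply Rinv_0_lt_compat; nra].
    - apply Rmult_lt_reg_r with ((1 + t) ^ 2); [nra|].
      unfold Rdiv; rewrite Rmult_assoc, Rinv_l by nra; nra. }
  assert (DF : forall t, 0 <= t < 1 -> is_derive hypF t (hypF' t))
    by (intros; apply hypF_derive, Rabs_def1; lra).
  assert (DH : forall t, 0 <= t < 1 -> is_derive hypH t (hypF t / 4))
    by (intros; apply hypH_derive, Rabs_def1; lra).
  assert (Hsq : forall t, 0 <= t < 1 -> 0 <= t ^ 2 < 1) by (intros; nra).
  (* With p = t (1 - t) / (1 + t), the chain rule gives [hypH (m t)] = p (F(m(t)))', and the bracket
     is p ((1 + t) F(t^2))'. So W is p times the Wronskian, written through [hypH] so that its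
     derivative involves no second derivative of F. *)
  set (W := fun t => hypH (m t) * ((1 + t) * hypF (t ^ 2)) -
    (t * (1 - t) / (1 + t) * hypF (t ^ 2) + 2 * hypH (t ^ 2) / (1 + t)) * hypF (m t)).
  assert (DW : forall t, 0 <= t < 1 -> is_derive W t 0).
  { intros t Ht; unfold W, m.
    pose proof (DF _ (Hm t Ht)) as D1; pose proof (DF _ (Hsq t Ht)) as D2.
    pose proof (DH _ (Hm t Ht)) as D3; pose proof (DH _ (Hsq t Ht)) as D4.
    unfold m in *.
    auto_derive.
    - repeat split; try (eexists; eassumption); try lra; try nra.
    - change (t * (t * 1)) with (t ^ 2).
      change (4 * t * / ((1 + t) * ((1 + t) * 1))) with (4 * t / (1 + t) ^ 2).
      change (fun x0 : R => hypH x0) with hypH; change (fun x0 : R => hypF x0) with hypF.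
      rewrite (is_derive_unique _ _ _ D1), (is_derive_unique _ _ _ D2),
        (is_derive_unique _ _ _ D3), (is_derive_unique _ _ _ D4).
      unfold hypH; set (u := hypF' (4 * t / (1 + t) ^ 2)); set (v := hypF (4 * t / (1 + t) ^ 2)).
      set (u' := hypF' (t ^ 2)); set (v' := hypF (t ^ 2)).
      field; lra. }
  assert (W0 : forall t, 0 <= t < 1 -> W t = 0).
  { intros t Ht; destruct (Req_dec t 0) as [->|Ht0].
    - unfold W, hypH, m; field.
    - transitivity (W 0); [symmetry|unfold W, hypH, m; field].
      apply (eq_is_derive W 0 t); [|lra]; intros r Hr; apply DW; lra. }
  set (f := fun t => hypF (m t) / ((1 + t) * hypF (t ^ 2))).
  (* The weight p vanishes at 0, so W = 0 yields a zero derivative only for t > 0; the mean value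
     theorem needs no more than continuity at 0. *)
  assert (Df : forall t, 0 <= t < 1 -> exists l, is_derive f t l /\ (0 < t -> l = 0)).
  { intros t Ht.
    pose proof (DF _ (Hm t Ht)) as D1; pose proof (DF _ (Hsq t Ht)) as D2.
    pose proof (hypF_ge_1 _ (Hsq t Ht)) as P2.
    exists ((hypF' (m t) * (4 * (1 - t) / (1 + t) ^ 3) * ((1 + t) * hypF (t ^ 2)) -
             hypF (m t) * (hypF (t ^ 2) + (1 + t) * (hypF' (t ^ 2) * (2 * t)))) / ((1 + t) * hypF (t ^ 2)) ^ 2).
    split.
    - unfold f, m in *; auto_derive.
      + repeat split; try (eexists; eassumption); try lra; try nra.
        apply Rmult_integral_contrapositive_currified; simpl in P2 |- *; lra.
      + change (t * (t * 1)) with (t ^ 2).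
        change (4 * t * / ((1 + t) * ((1 + t) * 1))) with (4 * t / (1 + t) ^ 2).
        change (fun x0 : R => hypF x0) with hypF.
        rewrite (is_derive_unique _ _ _ D1), (is_derive_unique _ _ _ D2).
        set (u := hypF' (4 * t / (1 + t) ^ 2)); set (v := hypF (4 * t / (1 + t) ^ 2)).
        set (u' := hypF' (t ^ 2)); set (v' := hypF (t ^ 2)) in *.
        field; lra.
    - intros Ht0; pose proof (W0 t Ht) as E; unfold W, hypH in E.
      set (u := hypF' (m t)) in *; set (v := hypF (m t)) in *.
      set (u' := hypF' (t ^ 2)) in *; set (v' := hypF (t ^ 2)) in *.
      unfold m in E.
      assert (E' : t * (1 - t) / (1 + t) * (u * (4 * (1 - t) / (1 + t) ^ 3) * ((1 + t) * v') -
             v * (v' + (1 + t) * (u' * (2 * t)))) = 0) by (rewrite <- E; field; lra).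
      apply Rmult_integral in E'; destruct E' as [E'|E'].
      + exfalso; assert (0 < t * (1 - t) / (1 + t)); [|lra].
        apply Rdiv_lt_0_compat; [apply Rmult_lt_0_compat|]; lra.
      + rewrite E'; apply Rmult_0_l. }
  destruct (MVT_gen f 0 x (fun _ => 0)) as [c [_ E]];
    rewrite ?Rmin_left, ?Rmax_right in * by lra.
  - intros t Ht; destruct (Df t ltac:(lra)) as [l [Hl Hl0]].
    rewrite Hl0 in Hl by lra; exact Hl.
  - intros t Ht; destruct (Df t ltac:(lra)) as [l [Hl _]].
    apply derivable_continuous_pt; exists l; now apply is_derive_Reals.
  - assert (E0 : f 0 = 1).
    { unfold f, m; replace (4 * 0 / (1 + 0) ^ 2) with 0 by field.
      replace (0 ^ 2) with 0 by ring; rewrite hypF_0; field. }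
    assert (Ex : f x = 1) by lra.
    pose proof (hypF_ge_1 _ (Hsq x Hx)).
    unfold f in Ex; change (4 * x / (1 + x) ^ 2) with (m x).
    apply (Rmult_eq_reg_r (/ ((1 + x) * hypF (x ^ 2)))).
    + unfold Rdiv in Ex; rewrite Ex; field; lra.
    + apply Rinv_neq_0_compat, Rmult_integral_contrapositive_currified; lra.
Qed.

(** * Logarithmic behaviour at 1 *)

Definition wallis (n : nat) : R := RInt (fun x => sin x ^ n) 0 (PI / 2).

Lemma ex_RInt_sin_pow n : ex_RInt (fun x => sin x ^ n) 0 (PI / 2).
Proof.
  apply (ex_RInt_continuous (V := R_CompleteNormedModule)); intros x _.
  apply (ex_derive_continuous (V := R_NormedModule)); auto_derive; easy.
Qed.

(** Integrates the derivative of sin^(n+1) cos, which vanishes at both ends. *)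
Lemma wallis_rec n : (INR n + 1) * wallis n = (INR n + 2) * wallis (S (S n)).
Proof.
  pose proof PI_RGT_0.
  assert (E : is_RInt (fun x => (INR n + 1) * sin x ^ n - (INR n + 2) * sin x ^ S (S n)) 0 (PI / 2)
    (minus (sin (PI / 2) ^ S n * cos (PI / 2)) (sin 0 ^ S n * cos 0))).
  { apply (is_RInt_derive (fun x => sin x ^ S n * cos x)).
    - intros x _; auto_derive; [easy|].
      replace (match n with 0%nat => 1 | S _ => INR n + 1 end) with (INR n + 1)
        by (destruct n; [simpl; ring|easy]).
      pose proof (sin2_cos2 x) as Hsc; unfold Rsqr in Hsc.
      simpl; replace (cos x * cos x) with (1 - sin x * sin x) by lra.
      transitivity ((INR n + 1) * sin x ^ n * (cos x * cos x) - sin x ^ n * (sin x * sin x)); [ring|].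
      replace (cos x * cos x) with (1 - sin x * sin x) by lra; ring.
    - intros x _.
      apply (ex_derive_continuous (V := R_NormedModule)); auto_derive; easy. }
  rewrite cos_PI2, sin_0 in E.
  assert (E2 : is_RInt (fun x => (INR n + 1) * sin x ^ n - (INR n + 2) * sin x ^ S (S n)) 0 (PI / 2)
     ((INR n + 1) * wallis n - (INR n + 2) * wallis (S (S n)))).
  { apply (is_RInt_minus (V := R_NormedModule));
    apply (is_RInt_scal (V := R_NormedModule)); apply (RInt_correct (V := R_CompleteNormedModule)), ex_RInt_sin_pow. }
  apply (is_RInt_unique (V := R_CompleteNormedModule)) in E; apply (is_RInt_unique (V := R_CompleteNormedModule)) in E2.
  rewrite E in E2; unfold minus, plus, opp in E2; simpl in E2; lra.
Qed.

Lemma wallis_S_le n : wallis (S n) <= wallis n.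
Proof.
  pose proof PI_RGT_0.
  apply RInt_le; [lra|apply ex_RInt_sin_pow|apply ex_RInt_sin_pow|].
  intros x Hx; assert (0 <= sin x) by (apply sin_ge_0; lra).
  pose proof (SIN_bound x).
  assert (0 <= sin x ^ n) by now apply pow_le.
  simpl; nra.
Qed.

Lemma wallis_0 : wallis 0 = PI / 2.
Proof.
  unfold wallis; simpl; rewrite (RInt_const (V := R_CompleteNormedModule)).
  unfold scal; simpl; unfold mult; simpl; ring.
Qed.

Lemma wallis_1 : wallis 1 = 1.
Proof.
  apply (is_RInt_unique (V := R_CompleteNormedModule)).
  replace 1 with (minus (- cos (PI / 2)) (- cos 0))
    by (rewrite cos_PI2, cos_0; unfold minus, plus, opp; simpl; ring).
  apply (is_RInt_derive (fun x => - cos x)).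
  - intros x _; auto_derive; [easy|ring].
  - intros x _; apply (ex_derive_continuous (V := R_NormedModule)); auto_derive; easy.
Qed.

(** The even Wallis integral is (PI / 2) (1/2)_n / n!, so its square exhibits the hypergeometric
    coefficient. *)
Lemma wallis_even n : wallis (2 * n) ^ 2 = (PI / 2) ^ 2 * hc n.
Proof.
  induction n as [|n IH]; [simpl; rewrite wallis_0; ring|].
  replace (2 * S n)%nat with (S (S (2 * n))) by lia.
  change (hc (S n)) with (hc n * ((INR n + / 2) / (INR n + 1)) ^ 2).
  pose proof (wallis_rec (2 * n)) as E; rewrite mult_INR in E; change (INR 2) with 2 in E.
  pose proof (pos_INR n).
  rewrite <- Rmult_assoc, <- IH.
  replace (wallis (S (S (2 * n)))) with ((2 * INR n + 1) * wallis (2 * n) / (2 * INR n + 2))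
    by (rewrite E; field; lra).
  field; lra.
Qed.

Lemma wallis_prod n : INR (S n) * (wallis n * wallis (S n)) = PI / 2.
Proof.
  induction n as [|n IH]; [rewrite wallis_0, wallis_1; simpl; ring|].
  rewrite <- IH. pose proof (wallis_rec n) as E; rewrite !S_INR.
  transitivity (wallis (S n) * ((INR n + 2) * wallis (S (S n)))); [ring|].
  rewrite <- E; ring.
Qed.

Lemma wallis_pos n : 0 < wallis n.
Proof.
  assert (H0 : 0 <= wallis n).
  { pose proof PI_RGT_0; apply RInt_ge_0; [lra|apply ex_RInt_sin_pow|].
    intros x Hx; apply pow_le, sin_ge_0; lra. }
  pose proof (wallis_prod n); pose proof PI_RGT_0.
  destruct H0 as [|H0]; [easy|]; rewrite <- H0, Rmult_0_l, Rmult_0_r in H; lra.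
Qed.

(** Since the integrals W decrease, PI / 2 = (2n+1) W_(2n) W_(2n+1) <= (2n+1) W_(2n)^2, and
    [wallis_even] evaluates the square. *)
Lemma hc_lower n : / PI * / INR (S n) <= hc n.
Proof.
  pose proof (wallis_prod (2 * n)) as E; pose proof (wallis_even n) as E2.
  pose proof (wallis_S_le (2 * n)); pose proof (wallis_pos (2 * n)); pose proof PI_RGT_0.
  pose proof (wallis_pos (S (2 * n))).
  rewrite S_INR, mult_INR in E; rewrite S_INR; change (INR 2) with 2 in E.
  pose proof (pos_INR n); set (w := wallis (2 * n)) in *; set (w' := wallis (S (2 * n))) in *.
  assert (w * w' <= w ^ 2) by nra.
  assert (PI / 2 <= (2 * INR n + 1) * ((PI / 2) ^ 2 * hc n)).
  { rewrite <- E2, <- E; apply Rmult_le_compat_l; lra. }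
  apply Rmult_le_reg_l with (PI * (INR n + 1)); [nra|].
  replace (PI * (INR n + 1) * (/ PI * / (INR n + 1))) with 1 by (field; lra).
  assert (1 <= (2 * INR n + 1) * (PI / 2) * hc n).
  { apply Rmult_le_reg_l with (PI / 2); [lra|]. nra. }
  pose proof (hc_pos_le1 n); nra.
Qed.

(** The same monotonicity one step later: PI / 2 = (2n+2) W_(2n+1) W_(2n+2) >= (2n+2) W_(2n+2)^2. *)
Lemma hc_upper n : hc (S n) <= / PI * / INR (S n).
Proof.
  pose proof (wallis_prod (S (2 * n))) as E; pose proof (wallis_even (S n)) as E2.
  replace (2 * S n)%nat with (S (S (2 * n))) in E2 by lia.
  pose proof (wallis_S_le (S (2 * n))); pose proof (wallis_pos (S (2 * n))); pose proof PI_RGT_0.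
  pose proof (wallis_pos (S (S (2 * n)))).
  rewrite !S_INR, mult_INR in E; rewrite S_INR; change (INR 2) with 2 in E.
  pose proof (pos_INR n); set (w := wallis (S (2 * n))) in *; set (w' := wallis (S (S (2 * n)))) in *.
  assert (w' ^ 2 <= w * w') by nra.
  assert ((2 * INR n + 1 + 1) * ((PI / 2) ^ 2 * hc (S n)) <= PI / 2).
  { rewrite <- E2, <- E; apply Rmult_le_compat_l; lra. }
  apply Rmult_le_reg_l with (PI * (INR n + 1)); [nra|].
  replace (PI * (INR n + 1) * (/ PI * / (INR n + 1))) with 1 by (field; lra).
  apply Rmult_le_reg_l with (PI / 2); [lra|]. nra.
Qed.

Lemma is_series_log x : Rabs x < 1 -> is_series (fun n => x ^ S n / INR (S n)) (- ln (1 - x)).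
Proof.
  intros Hx.
  set (l := fun n => match n with O => 0 | S m => / INR (S m) end).
  assert (CV : forall y, Rabs y < 1 -> Rbar_lt (Rabs y) (CV_radius l)).
  { intros y Hy; apply Rbar_lt_le_trans with 1; [easy|].
    apply CV_radius_ge_1; intros [|n]; unfold l; [rewrite Rabs_R0; lra|].
    pose proof (pos_INR n); rewrite S_INR.
    rewrite Rabs_pos_eq by (left; apply Rinv_0_lt_compat; lra).
    rewrite <- Rinv_1; apply Rinv_le_contravar; lra. }
  assert (Hder : forall y, Rabs y < 1 -> is_derive (fun t => PSeries l t + ln (1 - t)) y 0).
  { intros y Hy; pose proof (is_derive_PSeries l y (CV y Hy)) as D.
    assert (E : PSeries (PS_derive l) y = / (1 - y)).
    { apply is_pseries_unique, is_pseries_R.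
      apply is_series_ext with (fun n => y ^ n); [|now apply is_series_geom].
      intros n; unfold PS_derive, l; rewrite Rinv_r by (apply not_0_INR; lia); symmetry; apply Rmult_1_l. }
    rewrite E in D; apply Rabs_def2 in Hy.
    auto_derive; [split; [eexists; exact D|split; [lra|easy]]|].
    change (fun x0 : R => PSeries l x0) with (PSeries l).
    rewrite (is_derive_unique _ _ _ D); field; lra. }
  assert (E : PSeries l x = - ln (1 - x)).
  { assert (K : PSeries l x + ln (1 - x) = PSeries l 0 + ln (1 - 0)).
    { apply Rabs_def2 in Hx.
      destruct (MVT_gen (fun t => PSeries l t + ln (1 - t)) 0 x (fun _ => 0)) as [c [_ E]].
      - intros t Ht; apply Hder; revert Ht; unfold Rmin, Rmax; destruct Rle_dec; intros;
          apply Rabs_def1; lra.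
      - intros t Ht; apply derivable_continuous_pt; exists 0.
        apply is_derive_Reals, Hder; revert Ht; unfold Rmin, Rmax; destruct Rle_dec; intros;
          apply Rabs_def1; lra.
      - lra. }
    rewrite PSeries_0, Rminus_0_r, ln_1 in K; simpl in K; lra. }
  assert (Hs : is_series (fun n => l n * x ^ n) (- ln (1 - x))).
  { rewrite <- E; apply Series_correct, (proj1 (ex_pseries_R _ _)), CV_radius_inside, CV, Hx. }
  apply is_series_ext with (fun n => l (S n) * x ^ S n).
  - intros n; unfold l; apply Rmult_comm.
  - replace (- ln (1 - x)) with (- ln (1 - x) - l 0%nat * x ^ 0) by (simpl; ring).
    apply (is_series_incr_1 (fun n => l n * x ^ n)).
    replace (plus _ _) with (- ln (1 - x)) by (unfold plus; simpl; ring); easy.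
Qed.

(** With x = 1 - y, termwise comparison with the series of - ln (1 - x) / PI. From below, c_n x^n is
    compared with x^(n+1) / (PI (n+1)); from above, c_(n+1) x^(n+1) is, after setting aside the head
    c_0 = 1. *)
Lemma hypF_log_bounds y : 0 < y <= 1 -> / PI * - ln y <= hypF (1 - y) <= 1 + / PI * - ln y.
Proof.
  intros Hy; set (x := 1 - y).
  assert (Hx : Rabs x < 1) by (apply Rabs_def1; unfold x; lra).
  assert (Hx0 : 0 <= x) by (unfold x; lra).
  pose proof (is_series_log x Hx) as HL.
  replace (1 - x) with y in HL by (unfold x; ring).
  assert (HF : is_series (fun n => hc n * x ^ n) (hypF x)).
  { apply Series_correct, (proj1 (ex_pseries_R _ _)), CV_radius_inside, CV_hc, Hx. }
  assert (HS : is_series (fun n => / PI * (x ^ S n / INR (S n))) (/ PI * - ln y))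
    by exact (is_series_scal_l (/ PI) _ _ HL).
  assert (0 < / PI) by apply Rinv_0_lt_compat, PI_RGT_0.
  assert (Hp : forall n, 0 <= / PI * (x ^ S n / INR (S n))).
  { intros n; apply Rmult_le_pos; [lra|]; apply Rmult_le_pos; [now apply pow_le|].
    left; apply Rinv_0_lt_compat; rewrite S_INR; pose proof (pos_INR n); lra. }
  split.
  - rewrite <- (is_series_unique _ _ HS), <- (is_series_unique _ _ HF).
    apply Series_le; [|now exists (hypF x)].
    intros n; split; [apply Hp|].
    pose proof (hc_lower n).
    assert (0 <= x ^ n) by now apply pow_le.
    apply Rle_trans with (/ PI * / INR (S n) * x ^ n).
    + assert (x ^ S n <= x ^ n) by (simpl; assert (x <= 1) by (unfold x; lra); nra).
      replace (/ PI * (x ^ S n / INR (S n))) with (/ PI * / INR (S n) * x ^ S n) by (unfold Rdiv; ring).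
      apply Rmult_le_compat_l; [|easy].
      apply Rmult_le_pos; [lra|]; left; apply Rinv_0_lt_compat; rewrite S_INR; pose proof (pos_INR n); lra.
    + now apply Rmult_le_compat_r.
  - rewrite <- (is_series_unique _ _ HF), Series_incr_1 by now exists (hypF x).
    rewrite <- (is_series_unique _ _ HS); simpl (hc 0 * x ^ 0); rewrite Rmult_1_l.
    apply Rplus_le_compat_l, Series_le; [|eexists; exact HS].
    intros n; pose proof (hc_upper n); pose proof (hc_pos_le1 (S n)).
    assert (0 <= x ^ S n) by now apply pow_le.
    split; [apply Rmult_le_pos; lra|].
    apply Rle_trans with (/ PI * / INR (S n) * x ^ S n); [now apply Rmult_le_compat_r|].
    right; unfold Rdiv; ring.
Qed.

(** * The modulus as a function of the nome *)

Definition km (s : R) : R := th2 s ^ 2 / th3 s ^ 2.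
Definition km' (s : R) : R := th4 s ^ 2 / th3 s ^ 2.

Lemma exp_opp_le_inv s : 0 <= s -> exp (- s) <= / (1 + s).
Proof.
  intros Hs; rewrite exp_Ropp; apply Rinv_le_contravar; [lra|].
  apply exp_ineq1_le.
Qed.

Lemma th3_pos s : 0 < s -> 0 < th3 s.
Proof. intros Hs; pose proof (th3_bounds s Hs); lra. Qed.

Lemma th2_pos s : 0 < s -> 0 < th2 s.
Proof. intros Hs; pose proof (th2_bounds s Hs); pose proof (gauss_pos s (/ 2)); lra. Qed.

Lemma geom_bound_3 s : 1 <= s -> (1 + exp (- s)) / (1 - exp (- s)) <= 3.
Proof.
  intros Hs; pose proof (exp_opp_bounds s ltac:(lra)); pose proof (exp_opp_le_inv s ltac:(lra)).
  assert (/ (1 + s) <= / 2) by (apply Rinv_le_contravar; lra).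
  apply Rmult_le_reg_r with (1 - exp (- s)); [lra|].
  unfold Rdiv; rewrite Rmult_assoc, Rinv_l by lra; lra.
Qed.

Lemma th3_le_3 s : 1 <= s -> th3 s <= 3.
Proof.
  intros Hs; pose proof (th3_bounds s ltac:(lra)); pose proof (geom_bound_3 s Hs); lra.
Qed.

Lemma gauss_half s : gauss s (/ 2) = exp (- (s / 4)).
Proof. unfold gauss; f_equal; field. Qed.

Lemma th2_le_exp s : 1 <= s -> th2 s <= 6 * exp (- (s / 4)).
Proof.
  intros Hs; pose proof (th2_bounds s ltac:(lra)) as [_ Hb]; pose proof (geom_bound_3 s Hs).
  rewrite <- gauss_half; pose proof (gauss_pos s (/ 2)); nra.
Qed.

Lemma th4_nonneg s : 0 < s -> 0 <= th4 s.
Proof.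
  intros Hs; destruct (abs_summable_has_sum _ (abs_summable_theta_char s 0 Hs)) as [T HT].
  apply (theta_min s 0 T Hs HT).
Qed.

(** If theta4 vanished at s, [th3_th4] would make it vanish at 2 s, so it suffices to reach large s
    by doubling. There theta2 < 1 <= theta3 at 2 s, and [th4_sqr] is positive: for s >= 24 the bound
    is theta2 (2 s) <= 6 exp (-12) <= 6 / 13. *)
Lemma th4_pos s : 0 < s -> 0 < th4 s.
Proof.
  intros Hs.
  assert (Hn : forall n s, 0 < s -> 24 <= 2 ^ n * s -> 0 < th4 s).
  { clear s Hs; induction n as [|n IH]; intros s Hs Hb.
    - destruct (th4_nonneg s Hs) as [|E]; [easy|exfalso].
      pose proof (th4_sqr s Hs) as Q; rewrite <- E in Q; simpl in Hb.
      pose proof (th2_le_exp (2 * s) ltac:(lra)).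
      pose proof (exp_opp_le_inv (2 * s / 4) ltac:(lra)).
      assert (/ (1 + 2 * s / 4) <= / 13) by (apply Rinv_le_contravar; lra).
      pose proof (th3_bounds (2 * s) ltac:(lra)); pose proof (th2_pos (2 * s) ltac:(lra)); nra.
    - assert (H2 : 0 < th4 (2 * s)) by (apply IH; simpl in Hb; lra).
      destruct (th4_nonneg s Hs) as [|E]; [easy|exfalso].
      pose proof (th3_th4 s Hs) as Q; rewrite <- E in Q; nra. }
  destruct (Pow_x_infinity 2 ltac:(rewrite Rabs_pos_eq; lra) (24 / s)) as [N HN].
  specialize (HN N ltac:(lia)); apply (Hn N); [easy|].
  rewrite Rabs_pos_eq in HN by (apply pow_le; lra).
  apply Rge_le, (Rmult_le_compat_r s) in HN; [|lra].
  replace (24 / s * s) with 24 in HN by (field; lra); easy.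
Qed.

Lemma km_sqr_sum s : 0 < s -> km s ^ 2 + km' s ^ 2 = 1.
Proof.
  intros Hs; pose proof (th3_pos s Hs); unfold km, km'.
  transitivity ((th2 s ^ 4 + th4 s ^ 4) / th3 s ^ 4); [field; lra|].
  rewrite <- jacobi_quartic by easy; field; lra.
Qed.

Lemma km_bounds s : 0 < s -> 0 < km s < 1.
Proof.
  intros Hs; pose proof (km_sqr_sum s Hs).
  assert (0 < km s) by (apply Rdiv_lt_0_compat; apply pow_lt; [now apply th2_pos|now apply th3_pos]).
  assert (0 < km' s) by (apply Rdiv_lt_0_compat; apply pow_lt; [now apply th4_pos|now apply th3_pos]).
  split; nra.
Qed.

Lemma km'_bounds s : 0 < s -> 0 < km' s < 1.
Proof.
  intros Hs; pose proof (km_sqr_sum s Hs); pose proof (km_bounds s Hs).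
  assert (0 < km' s) by (apply Rdiv_lt_0_compat; apply pow_lt; [now apply th4_pos|now apply th3_pos]).
  split; nra.
Qed.

(** Landen's transformation at x = k(2s): the duplication formulas give 4 x / (1 + x)^2 = k(s)^2 and
    1 + x = theta3(s)^2 / theta3(2s)^2. *)
Lemma km_double s : 0 < s -> hypF (km s ^ 2) / th3 s ^ 2 = hypF (km (2 * s) ^ 2) / th3 (2 * s) ^ 2.
Proof.
  intros Hs; pose proof (km_bounds (2 * s) ltac:(lra)) as Hk.
  pose proof (landen (km (2 * s)) ltac:(lra)) as L.
  pose proof (th3_pos s Hs); pose proof (th3_pos (2 * s) ltac:(lra)).
  pose proof (th3_sqr s Hs) as E3; pose proof (th2_sqr s Hs) as E2.
  assert (K1 : 4 * km (2 * s) / (1 + km (2 * s)) ^ 2 = km s ^ 2).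
  { unfold km.
    transitivity (4 * (th2 (2 * s) * th3 (2 * s)) ^ 2 /
      (th3 (2 * s) * th3 (2 * s) + th2 (2 * s) * th2 (2 * s)) ^ 2); [field; nra|].
    transitivity ((th2 s * th2 s) ^ 2 / (th3 s * th3 s) ^ 2); [|field; lra].
    rewrite E2, E3; field; nra. }
  rewrite K1 in L; rewrite L.
  replace (1 + km (2 * s)) with (th3 s ^ 2 / th3 (2 * s) ^ 2); [field; lra|].
  replace (th3 s ^ 2) with (th3 s * th3 s) by ring; rewrite E3; unfold km; field; lra.
Qed.

(** Here Landen's transformation is taken at x = k'(s), so it leads from s to 2 s; the factor 2
    comes from 1 + x = 2 theta3(2s)^2 / theta3(s)^2. *)
Lemma km'_double s : 0 < s ->
  hypF (km' s ^ 2) / th3 s ^ 2 = hypF (km' (2 * s) ^ 2) / th3 (2 * s) ^ 2 / 2.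
Proof.
  intros Hs; pose proof (km'_bounds s Hs) as Hk.
  pose proof (landen (km' s) ltac:(lra)) as L.
  pose proof (th3_pos s Hs); pose proof (th3_pos (2 * s) ltac:(lra)).
  pose proof (th3_sqr s Hs) as E3; pose proof (th4_sqr s Hs) as E4; pose proof (th3_th4 s Hs) as E34.
  assert (ES : th3 s ^ 2 + th4 s ^ 2 = 2 * th3 (2 * s) ^ 2) by (simpl; lra).
  assert (K1 : 4 * km' s / (1 + km' s) ^ 2 = km' (2 * s) ^ 2).
  { unfold km'.
    transitivity (4 * (th3 s * th4 s) ^ 2 / (th3 s ^ 2 + th4 s ^ 2) ^ 2); [field; nra|].
    rewrite ES, E34; field; lra. }
  rewrite K1 in L; rewrite L.
  replace (1 + km' s) with (2 * th3 (2 * s) ^ 2 / th3 s ^ 2); [field; lra|].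
  rewrite <- ES; unfold km'; field; lra.
Qed.

Lemma km_double_iter s n : 0 < s ->
  hypF (km s ^ 2) / th3 s ^ 2 = hypF (km (2 ^ n * s) ^ 2) / th3 (2 ^ n * s) ^ 2.
Proof.
  intros Hs; induction n as [|n IH]; [simpl; rewrite Rmult_1_l; easy|].
  rewrite IH, km_double by (apply Rmult_lt_0_compat; [apply pow_lt; lra|easy]).
  now rewrite <- Rmult_assoc.
Qed.

Lemma km'_double_iter s n : 0 < s ->
  hypF (km' s ^ 2) / th3 s ^ 2 = hypF (km' (2 ^ n * s) ^ 2) / th3 (2 ^ n * s) ^ 2 / 2 ^ n.
Proof.
  intros Hs; induction n as [|n IH]; [simpl; rewrite Rmult_1_l; field|].
  - pose proof (th3_pos s Hs); lra.
  - rewrite IH, km'_double by (apply Rmult_lt_0_compat; [apply pow_lt; lra|easy]).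
    replace (2 * (2 ^ n * s)) with (2 ^ S n * s) by (simpl; ring).
    set (X := hypF (km' (2 ^ S n * s) ^ 2) / th3 (2 ^ S n * s) ^ 2).
    assert (2 ^ n <> 0) by (apply pow_nonzero; lra).
    simpl; field; easy.
Qed.

Lemma is_lim_seq_exp_pow2 c s : 0 < c -> 0 < s -> is_lim_seq (fun n => exp (- (2 ^ n * s / c))) 0.
Proof.
  intros Hc Hs.
  assert (Hg : is_lim_seq (fun n => 2 ^ n * (s / c)) p_infty).
  { replace p_infty with (Rbar_mult p_infty (s / c)).
    - apply is_lim_seq_scal_r, is_lim_seq_geom_p; lra.
    - apply is_Rbar_mult_unique, is_Rbar_mult_p_infty_pos; simpl; now apply Rdiv_lt_0_compat. }
  apply is_lim_seq_le_le with (fun _ => 0) (fun n => / (2 ^ n * (s / c))).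
  - intros n; split; [left; apply exp_pos|].
    assert (0 < 2 ^ n * (s / c)).
    { apply Rmult_lt_0_compat; [apply pow_lt; lra|now apply Rdiv_lt_0_compat]. }
    replace (2 ^ n * s / c) with (2 ^ n * (s / c)) by (unfold Rdiv; ring).
    eapply Rle_trans; [apply exp_opp_le_inv; lra|]; apply Rinv_le_contravar; lra.
  - apply is_lim_seq_const.
  - replace (Finite 0) with (Rbar_inv p_infty) by easy.
    now apply is_lim_seq_inv.
Qed.

Lemma pow2_pos n s : 0 < s -> 0 < 2 ^ n * s.
Proof. intros; apply Rmult_lt_0_compat; [apply pow_lt; lra|easy]. Qed.

Lemma eventually_pow2_ge_1 s : 0 < s -> eventually (fun n => 1 <= 2 ^ n * s).
Proof.
  intros Hs; destruct (Pow_x_infinity 2 ltac:(rewrite Rabs_pos_eq; lra) (1 / s)) as [N HN].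
  exists N; intros n Hn; specialize (HN n Hn).
  rewrite Rabs_pos_eq in HN by (apply pow_le; lra).
  apply Rge_le, (Rmult_le_compat_r s) in HN; [|lra].
  replace (1 / s * s) with 1 in HN by (field; lra); easy.
Qed.

Lemma is_lim_seq_th3 s : 0 < s -> is_lim_seq (fun n => th3 (2 ^ n * s)) 1.
Proof.
  intros Hs.
  pose proof (is_lim_seq_exp_pow2 1 s ltac:(lra) Hs) as He.
  apply is_lim_seq_le_le with (fun _ => 1)
    (fun n => (1 + exp (- (2 ^ n * s / 1))) / (1 - exp (- (2 ^ n * s / 1)))).
  - intros n; rewrite Rdiv_1_r; apply th3_bounds, pow2_pos, Hs.
  - apply is_lim_seq_const.
  - replace (Finite 1) with (Finite ((1 + 0) / (1 - 0))) by (f_equal; field).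
    apply is_lim_seq_div'; [|apply is_lim_seq_minus'; [apply is_lim_seq_const|easy]|lra].
    apply is_lim_seq_plus'; [apply is_lim_seq_const|easy].
Qed.

Lemma is_lim_seq_km s : 0 < s -> is_lim_seq (fun n => km (2 ^ n * s) ^ 2) 0.
Proof.
  intros Hs.
  pose proof (is_lim_seq_exp_pow2 4 s ltac:(lra) Hs) as He.
  apply (is_lim_seq_le_le_loc (fun _ => 0) _ (fun n => 6 * exp (- (2 ^ n * s / 4)))).
  - destruct (eventually_pow2_ge_1 s Hs) as [N1 HN1].
    assert (He' : eventually (fun n => 6 * exp (- (2 ^ n * s / 4)) < 1)).
    { apply is_lim_seq_spec in He; destruct (He (mkposreal (/ 6) ltac:(lra))) as [N HN].
      exists N; intros n Hn; specialize (HN n Hn); simpl in HN.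
      rewrite Rminus_0_r, Rabs_pos_eq in HN by (left; apply exp_pos); lra. }
    destruct He' as [N2 HN2]; exists (Nat.max N1 N2); intros n Hn.
    specialize (HN1 n ltac:(lia)); specialize (HN2 n ltac:(lia)).
    pose proof (th2_le_exp _ HN1); pose proof (th2_pos _ (pow2_pos n s Hs)).
    pose proof (th3_bounds _ (pow2_pos n s Hs)) as [H3 _].
    pose proof (km_bounds _ (pow2_pos n s Hs)).
    assert (km (2 ^ n * s) <= th2 (2 ^ n * s)).
    { set (a := th2 (2 ^ n * s)) in *; assert (H9 : 1 <= th3 (2 ^ n * s) ^ 2) by nra.
      assert (a ^ 2 <= a) by nra.
      unfold km; fold a; apply Rmult_le_reg_r with (th3 (2 ^ n * s) ^ 2); [lra|].
      unfold Rdiv; rewrite Rmult_assoc, Rinv_l by lra; nra. }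
    nra.
  - apply is_lim_seq_const.
  - replace (Finite 0) with (Rbar_mult 6 0) by (simpl; f_equal; ring).
    now apply is_lim_seq_scal_l.
Qed.

Lemma is_lim_seq_const_eq (a b : R) : is_lim_seq (fun _ => a) b -> a = b.
Proof.
  intros L; apply is_lim_seq_unique in L; rewrite Lim_seq_const in L.
  now injection L.
Qed.

(** The quotient F(k^2) / theta3^2 is constant along s, 2 s, 4 s, ..., where k -> 0 and theta3 -> 1;
    hence it is F(0) = 1. *)
Lemma th3_sqr_hypF s : 0 < s -> th3 s ^ 2 = hypF (km s ^ 2).
Proof.
  intros Hs.
  assert (L : is_lim_seq (fun n => hypF (km (2 ^ n * s) ^ 2) / th3 (2 ^ n * s) ^ 2) 1).
  { replace (Finite 1) with (Finite (hypF 0 / (1 * 1))) by (rewrite hypF_0; f_equal; field).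
    apply is_lim_seq_div'; [| |lra].
    - apply (is_lim_seq_continuous hypF (fun n => km (2 ^ n * s) ^ 2) 0); [|now apply is_lim_seq_km].
      apply derivable_continuous_pt; exists (hypF' 0).
      apply is_derive_Reals, hypF_derive; rewrite Rabs_R0; lra.
    - apply is_lim_seq_ext with (fun n => th3 (2 ^ n * s) * th3 (2 ^ n * s)); [intros; ring|].
      apply is_lim_seq_mult'; now apply is_lim_seq_th3. }
  apply (is_lim_seq_ext _ (fun _ => hypF (km s ^ 2) / th3 s ^ 2)) in L;
    [|intros n; symmetry; now apply km_double_iter].
  apply is_lim_seq_const_eq in L.
  pose proof (th3_pos s Hs).
  transitivity (hypF (km s ^ 2) / th3 s ^ 2 * th3 s ^ 2); [rewrite L; ring|field; lra].
Qed.

(** Here - ln (k^2) = 4 ln theta3 - 4 ln theta2, with ln theta2 = - s / 4 up to a bounded error; 3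
    and 6 are the constants of [th3_le_3] and [th2_le_exp]. *)
Lemma hypF_km'_asymp s : 1 <= s ->
  Rabs (hypF (km' s ^ 2) - s / PI) <= 1 + / PI * (4 * ln 6 + 4 * ln 3).
Proof.
  intros Hs; assert (Hs0 : 0 < s) by lra.
  pose proof (km_bounds s Hs0) as Hk.
  replace (km' s ^ 2) with (1 - km s ^ 2) by (pose proof (km_sqr_sum s Hs0); lra).
  pose proof (hypF_log_bounds (km s ^ 2) ltac:(nra)) as HF.
  pose proof (th2_pos s Hs0); pose proof (th3_pos s Hs0).
  assert (E : - ln (km s ^ 2) = 4 * ln (th3 s) - 4 * ln (th2 s)).
  { replace (km s ^ 2) with ((th2 s * / th3 s) ^ 4) by (unfold km; field; lra).
    rewrite ln_pow by (apply Rmult_lt_0_compat; [easy|now apply Rinv_0_lt_compat]).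
    rewrite ln_mult, ln_Rinv by (try easy; now apply Rinv_0_lt_compat).
    simpl INR; ring. }
  assert (T3 : 0 <= ln (th3 s) <= ln 3).
  { pose proof (th3_bounds s Hs0); pose proof (th3_le_3 s Hs).
    rewrite <- ln_1; split; apply ln_le; lra. }
  assert (T2 : - (s / 4) <= ln (th2 s) <= ln 6 - s / 4).
  { pose proof (th2_bounds s Hs0) as [L _]; pose proof (th2_le_exp s Hs) as U.
    rewrite gauss_half in L; pose proof (exp_pos (- (s / 4))).
    apply ln_le in L; [|easy]; apply ln_le in U; [|easy].
    rewrite ln_mult in U by lra; rewrite ln_exp in L, U; lra. }
  rewrite E in HF.
  assert (0 < / PI) by apply Rinv_0_lt_compat, PI_RGT_0.
  assert (0 <= ln 6) by (rewrite <- ln_1; apply ln_le; lra).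
  replace (s / PI) with (/ PI * s) by (unfold Rdiv; ring).
  apply Rabs_le; split; nra.
Qed.

Lemma hypF_km' s : 0 < s -> hypF (km' s ^ 2) = s / PI * th3 s ^ 2.
Proof.
  intros Hs; pose proof PI_RGT_0 as HPI; set (K := 1 + / PI * (4 * ln 6 + 4 * ln 3)).
  assert (L1 : is_lim_seq (fun n => hypF (km' (2 ^ n * s) ^ 2) / 2 ^ n - s / PI) 0).
  { apply is_lim_seq_abs_0.
    apply (is_lim_seq_le_le_loc (fun _ => 0) _ (fun n => K * / 2 ^ n)).
    - destruct (eventually_pow2_ge_1 s Hs) as [N HN]; exists N; intros n Hn.
      split; [apply Rabs_pos|].
      assert (H2 : 0 < 2 ^ n) by (apply pow_lt; lra).
      replace (hypF (km' (2 ^ n * s) ^ 2) / 2 ^ n - s / PI)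
        with ((hypF (km' (2 ^ n * s) ^ 2) - 2 ^ n * s / PI) * / 2 ^ n) by (field; lra).
      rewrite Rabs_mult, (Rabs_pos_eq (/ 2 ^ n)) by (left; now apply Rinv_0_lt_compat).
      apply Rmult_le_compat_r; [left; now apply Rinv_0_lt_compat|].
      now apply hypF_km'_asymp, HN.
    - apply is_lim_seq_const.
    - replace (Finite 0) with (Rbar_mult K 0) by (simpl; f_equal; ring).
      apply is_lim_seq_scal_l.
      apply is_lim_seq_ext with (fun n => (/ 2) ^ n); [intros; apply pow_inv|].
      apply is_lim_seq_geom; rewrite Rabs_pos_eq; lra. }
  assert (L2 : is_lim_seq (fun n => hypF (km' (2 ^ n * s) ^ 2) / th3 (2 ^ n * s) ^ 2 / 2 ^ n) (s / PI)).
  { apply is_lim_seq_ext with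
      (fun n => ((hypF (km' (2 ^ n * s) ^ 2) / 2 ^ n - s / PI) + s / PI) / (th3 (2 ^ n * s) * th3 (2 ^ n * s))).
    - intros n; pose proof (th3_pos _ (pow2_pos n s Hs)).
      assert (0 < 2 ^ n) by (apply pow_lt; lra); field; lra.
    - replace (Finite (s / PI)) with (Finite ((0 + s / PI) / (1 * 1))) by (f_equal; field; lra).
      apply is_lim_seq_div'; [| |lra].
      + apply is_lim_seq_plus'; [easy|apply is_lim_seq_const].
      + apply is_lim_seq_mult'; now apply is_lim_seq_th3. }
  apply (is_lim_seq_ext _ (fun _ => hypF (km' s ^ 2) / th3 s ^ 2)) in L2;
    [|intros n; symmetry; now apply km'_double_iter].
  apply is_lim_seq_const_eq in L2.
  pose proof (th3_pos s Hs); rewrite <- L2; field; lra.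
Qed.

(** * Recovering the modulus from the quotient of hypergeometric values *)

Lemma hypF_ratio_le u v : 0 < u < 1 -> 0 < v < 1 ->
  hypF (1 - u ^ 2) * hypF (v ^ 2) = hypF (1 - v ^ 2) * hypF (u ^ 2) -> v <= u.
Proof.
  intros Hu Hv E; apply Rnot_lt_le; intros Hlt.
  assert (hypF (u ^ 2) < hypF (v ^ 2)) by (apply hypF_increasing; nra).
  assert (hypF (1 - v ^ 2) < hypF (1 - u ^ 2)) by (apply hypF_increasing; nra).
  pose proof (hypF_ge_1 (u ^ 2) ltac:(nra)); pose proof (hypF_ge_1 (1 - v ^ 2) ltac:(nra)); nra.
Qed.

Lemma hypF_ratio_inj u v : 0 < u < 1 -> 0 < v < 1 ->
  hypF (1 - u ^ 2) * hypF (v ^ 2) = hypF (1 - v ^ 2) * hypF (u ^ 2) -> u = v.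
Proof. intros; apply Rle_antisym; now apply hypF_ratio_le. Qed.

Lemma hypF_km_ratio s : 0 < s -> hypF (1 - km s ^ 2) = s / PI * hypF (km s ^ 2).
Proof.
  intros Hs; rewrite <- th3_sqr_hypF, <- hypF_km' by easy; f_equal; pose proof (km_sqr_sum s Hs); lra.
Qed.

Lemma km_unique s u : 0 < s -> 0 < u < 1 -> hypF (1 - u ^ 2) = s / PI * hypF (u ^ 2) -> km s = u.
Proof.
  intros Hs Hu E; apply hypF_ratio_inj; [now apply km_bounds|easy|].
  rewrite hypF_km_ratio, E by easy; ring.
Qed.

(** Takes the place of the modular transformation: exchanging k and k' inverts the quotient s / PI,
    so k'(s) solves the equation that characterizes k at PI^2 / s. *)
Lemma km_reciprocal s s' : 0 < s -> 0 < s' -> s * s' = PI ^ 2 -> km s' = km' s.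
Proof.
  intros Hs Hs' E; pose proof PI_RGT_0; apply km_unique; [easy|now apply km'_bounds|].
  replace (1 - km' s ^ 2) with (km s ^ 2) by (pose proof (km_sqr_sum s Hs); lra).
  rewrite hypF_km', <- th3_sqr_hypF by easy.
  transitivity ((s * s') / PI ^ 2 * th3 s ^ 2); [rewrite E|]; field; lra.
Qed.

(** * Factorization of the heat kernel and the bijection *)

Definition theta_term (s phi : R) (k : Z) : R := cos (phi * IZR k) * gauss s (IZR k).

Lemma Zpartial_odd f N : (forall k, f (- k)%Z = - f k) -> Zpartial f N = 0.
Proof.
  intros Hf; induction N as [|N IH].
  - unfold Zpartial; simpl; pose proof (Hf 0%Z); simpl in *; lra.
  - rewrite Zpartial_S, IH, Hf; ring.
Qed.

Lemma Zpartial_ext f g N : (forall k, f k = g k) -> Zpartial f N = Zpartial g N.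
Proof. intros H; rewrite !Zpartial_lsum; apply lsum_ext; auto. Qed.

(** Already the square partial sums factor exactly: the cosine of the sum splits into a product of
    cosines minus a product of sines, and the sines cancel over symmetric ranges. Only a product of
    two limits remains. *)
Lemma p_alpha_prod alpha x y T T' : 0 < alpha ->
  has_sum (theta_term (PI * alpha ^ 2) (2 * PI * x)) T ->
  has_sum (theta_term (PI * / alpha ^ 2) (2 * PI * y)) T' ->
  p_alpha alpha x y 1 = T * T'.
Proof.
  intros Ha HT HT'; unfold p_alpha, Z2sum; apply lim_seq_unique.
  set (s := PI * alpha ^ 2) in *; set (s' := PI * / alpha ^ 2) in *.
  apply has_sum_Zpartial in HT; apply has_sum_Zpartial in HT'.
  pose proof (CV_mult _ _ _ _ HT HT') as H.
  intros e He; destruct (H e He) as [N0 HN]; exists N0; intros n Hn.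
  replace (Z2partial _ n) with (Zpartial (theta_term s (2 * PI * x)) n *
    Zpartial (theta_term s' (2 * PI * y)) n); [now apply HN|].
  set (f := fun k l : Z => _).
  change (Z2partial f n) with (Zpartial (fun k => Zpartial (f k) n) n).
  (* The sine parts are odd in [k], so their symmetric partial sums vanish. *)
  set (sx := fun k => sin (2 * PI * x * IZR k) * gauss s (IZR k)).
  set (sy := fun k => sin (2 * PI * y * IZR k) * gauss s' (IZR k)).
  assert (Hodd : forall z t n, Zpartial (fun k => sin (z * IZR k) * gauss t (IZR k)) n = 0).
  { intros z t m; apply Zpartial_odd; intros k; rewrite opp_IZR, gauss_opp.
    replace (z * - IZR k) with (- (z * IZR k)) by ring; rewrite sin_neg; ring. }
  assert (Hlin : forall (c d : R) g h, Zpartial (fun l => c * g l + d * h l) n =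
     c * Zpartial g n + d * Zpartial h n).
  { intros c d g h; rewrite !Zpartial_lsum, lsum_plus, !lsum_scal; easy. }
  rewrite (Zpartial_ext (fun k => Zpartial (f k) n)
    (fun k => Zpartial (theta_term s' (2 * PI * y)) n * theta_term s (2 * PI * x) k + 0 * sx k)).
  - rewrite Hlin; ring.
  - intros k.
    rewrite (Zpartial_ext (f k) (fun l => theta_term s (2 * PI * x) k * theta_term s' (2 * PI * y) l
      + - sx k * sy l)).
    + rewrite Hlin; unfold sy; rewrite Hodd; ring.
    + intros l; unfold f, theta_term, sx, sy.
      replace (2 * PI * (IZR k * x + IZR l * y)) with (2 * PI * x * IZR k + 2 * PI * y * IZR l) by ring.
      replace (- PI * 1 * (alpha ^ 2 * IZR k ^ 2 + / alpha ^ 2 * IZR l ^ 2))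
        with (- (s * IZR k ^ 2) + - (s' * IZR l ^ 2)) by (unfold s, s'; ring).
      rewrite exp_plus, cos_plus; unfold gauss; ring.
Qed.

Lemma exists_theta s phi : 0 < s -> exists T, has_sum (theta_term s phi) T /\ th4 s <= T <= th3 s.
Proof.
  intros Hs; destruct (abs_summable_has_sum _ (abs_summable_theta_char s phi Hs)) as [T HT].
  exists T; split; [exact HT|]; split; [now apply (theta_min s phi T)|now apply (theta_max s phi T)].
Qed.

Lemma kmod_km alpha : kmod alpha = km (PI * alpha ^ 2).
Proof.
  unfold kmod, km, th2, th3; cbv zeta.
  now replace (- PI * alpha ^ 2) with (- (PI * alpha ^ 2)) by ring.
Qed.

Lemma kmod'_km' alpha : kmod' alpha = km' (PI * alpha ^ 2).
Proof.
  unfold kmod', km', th4, th3; cbv zeta.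
  now replace (- PI * alpha ^ 2) with (- (PI * alpha ^ 2)) by ring.
Qed.

Lemma km'_inj s s' : 0 < s -> 0 < s' -> km' s = km' s' -> s = s'.
Proof.
  intros Hs Hs' E.
  assert (Ek : km s = km s').
  { pose proof (km_sqr_sum s Hs); pose proof (km_sqr_sum s' Hs').
    pose proof (km_bounds s Hs); pose proof (km_bounds s' Hs'); rewrite E in H; nra. }
  pose proof (hypF_km_ratio s Hs) as R1; pose proof (hypF_km_ratio s' Hs') as R2.
  rewrite Ek, R2 in R1; pose proof (km_bounds s' Hs').
  pose proof (hypF_ge_1 (km s' ^ 2) ltac:(nra)); pose proof PI_RGT_0.
  apply Rmult_eq_reg_r in R1; [|lra].
  apply Rmult_eq_reg_r in R1; [lra|apply Rinv_neq_0_compat; lra].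
Qed.

Lemma km'_surj u : 0 < u < 1 -> exists s, 0 < s /\ km' s = u.
Proof.
  intros Hu; set (v := sqrt (1 - u ^ 2)).
  assert (Hv2 : v ^ 2 = 1 - u ^ 2) by (apply pow2_sqrt; nra).
  assert (Hv : 0 < v < 1).
  { assert (0 < v) by (apply sqrt_lt_R0; nra); split; nra. }
  pose proof (hypF_ge_1 (v ^ 2) ltac:(nra)); pose proof (hypF_ge_1 (1 - v ^ 2) ltac:(nra)).
  pose proof PI_RGT_0.
  (* The explicit inverse, obtained by solving F(1 - v^2) = (s / PI) F(v^2) for s, with v the
     complementary modulus of u. *)
  set (s := PI * (hypF (1 - v ^ 2) / hypF (v ^ 2))).
  assert (Hs : 0 < s) by (apply Rmult_lt_0_compat; [easy|apply Rdiv_lt_0_compat; lra]).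
  exists s; split; [easy|].
  assert (E : km s = v) by (apply km_unique; [easy|easy|unfold s; field; lra]).
  pose proof (km_sqr_sum s Hs) as Q; rewrite E, Hv2 in Q.
  pose proof (km'_bounds s Hs); nra.
Qed.

Theorem mainTheorem4 :
  (forall alpha : R, 0 < alpha ->
     let q := exp (- PI * alpha ^ 2) in
     let r := exp (- PI * / alpha ^ 2) in
     let k := kmod alpha in
     let k' := kmod' alpha in
     let F := hyp2F1 (1/2) (1/2) 1 in
     let A := theta4 q * theta4 r in
     let B := theta3 q * theta3 r in
     (* k, k' in (0,1), k^2 + k'^2 = 1 *)
     (0 < k < 1 /\ 0 < k' < 1 /\ k ^ 2 + k' ^ 2 = 1) /\
     (* A(alpha;1) = min p_alpha(.,.;1) *)
     (forall x y : R, A <= p_alpha alpha x y 1) /\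
     (exists x y : R, p_alpha alpha x y 1 = A) /\
     (* B(alpha;1) = max p_alpha(.,.;1) *)
     (forall x y : R, p_alpha alpha x y 1 <= B) /\
     (exists x y : R, p_alpha alpha x y 1 = B) /\
     (* the closed forms *)
     A = theta2 q * theta2 r /\
     A = sqrt (k * k' * F (k ^ 2) * F (k' ^ 2)) /\
     B = sqrt (F (k ^ 2) * F (k' ^ 2))) /\
  (* alpha |-> k' is a bijection from (0,oo) onto (0,1) *)
  (forall a1 a2 : R, 0 < a1 -> 0 < a2 -> kmod' a1 = kmod' a2 -> a1 = a2) /\
  (forall u : R, 0 < u < 1 -> exists alpha : R, 0 < alpha /\ kmod' alpha = u).
Proof.
  pose proof PI_RGT_0 as HPI.
  split; [|split].
  - intros alpha Ha; cbv zeta; rewrite kmod_km, kmod'_km'.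
    replace (- PI * alpha ^ 2) with (- (PI * alpha ^ 2)) by ring.
    replace (- PI * / alpha ^ 2) with (- (PI * / alpha ^ 2)) by ring.
    assert (Ha2 : 0 < alpha ^ 2) by now apply pow_lt.
    assert (Hs : 0 < PI * alpha ^ 2) by nra.
    assert (Hs' : 0 < PI * / alpha ^ 2).
    { apply Rmult_lt_0_compat; [easy|now apply Rinv_0_lt_compat]. }
    assert (HP := fun x y T T' => p_alpha_prod alpha x y T T' Ha).
    assert (Hrec : PI * alpha ^ 2 * (PI * / alpha ^ 2) = PI ^ 2) by (field; lra).
    set (s := PI * alpha ^ 2) in *; set (s' := PI * / alpha ^ 2) in *.
    change (theta4 (exp (- s))) with (th4 s); change (theta4 (exp (- s'))) with (th4 s').
    change (theta3 (exp (- s))) with (th3 s); change (theta3 (exp (- s'))) with (th3 s').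
    change (theta2 (exp (- s))) with (th2 s); change (theta2 (exp (- s'))) with (th2 s').
    pose proof (km_bounds s Hs) as Hk; pose proof (km'_bounds s Hs) as Hk'.
    pose proof (th4_pos s Hs); pose proof (th4_pos s' Hs').
    pose proof (th3_pos s Hs); pose proof (th3_pos s' Hs').
    pose proof (th2_pos s Hs); pose proof (th2_pos s' Hs').
    assert (E1 : km s' = km' s) by now apply km_reciprocal.
    assert (E2 : km' s' = km s) by (symmetry; apply km_reciprocal; [easy|easy|]; lra).
    assert (Hk2 : 0 < km s ^ 2 < 1) by (split; nra).
    assert (Hk2' : 0 < km' s ^ 2 < 1) by (split; nra).
    rewrite !hyp2F1_hypF by (apply Rabs_def1; lra).
    (* Reading k'(s) as k(s') turns F(k'^2) into theta3(s')^2 as well, so both closed forms become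
       statements about theta-nulls. *)
    rewrite <- th3_sqr_hypF by easy; rewrite <- E1, <- th3_sqr_hypF by easy.
    split; [|split; [|split; [|split; [|split; [|split; [|split]]]]]].
    + split; [easy|split; [lra|]]; rewrite E1; now apply km_sqr_sum.
    + intros x y; destruct (exists_theta s (2 * PI * x) Hs) as [T [HT BT]].
      destruct (exists_theta s' (2 * PI * y) Hs') as [T' [HT' BT']].
      rewrite (HP _ _ _ _ HT HT'); apply Rmult_le_compat; lra.
    + exists (/ 2), (/ 2); apply HP; (eapply has_sum_ext; [|apply has_sum_th4; easy]);
        intros k; unfold theta_term; rewrite <- cos_PI_IZR; do 3 f_equal; field.
    + intros x y; destruct (exists_theta s (2 * PI * x) Hs) as [T [HT BT]].
      destruct (exists_theta s' (2 * PI * y) Hs') as [T' [HT' BT']].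
      rewrite (HP _ _ _ _ HT HT'); apply Rmult_le_compat; lra.
    + exists 0, 0; apply HP; (eapply has_sum_ext; [|apply has_sum_th3; easy]);
        intros k; unfold theta_term; rewrite Rmult_0_r, Rmult_0_l, cos_0; ring.
    (* Both squares equal k k' theta3(s)^2 theta3(s')^2, because passing from s to s' exchanges k
       and k'. *)
    + apply Rsqr_inj; [nra|nra|]; unfold Rsqr.
      transitivity (km s * km' s * (th3 s ^ 2 * th3 s' ^ 2)).
      * rewrite <- E2; unfold km'; field; lra.
      * rewrite <- E1; unfold km; field; lra.
    + symmetry; apply sqrt_lem_1; [|nra|].
      * assert (0 < th3 s ^ 2) by now apply pow_lt.
        assert (0 < th3 s' ^ 2) by now apply pow_lt.
        apply Rmult_le_pos; [apply Rmult_le_pos; [apply Rmult_le_pos|]|]; lra.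
      * rewrite <- E2 at 1; rewrite E1; unfold km'; field; lra.
    + symmetry; apply sqrt_lem_1; [|nra|ring].
      apply Rmult_le_pos; apply pow_le; lra.
  - intros a1 a2 H1 H2 E; rewrite !kmod'_km' in E.
    apply km'_inj in E; [|apply Rmult_lt_0_compat; [easy|now apply pow_lt]..].
    apply Rmult_eq_reg_l in E; [|lra]; nra.
  - intros u Hu; destruct (km'_surj u Hu) as [s [Hs E]].
    assert (0 < s / PI) by now apply Rdiv_lt_0_compat.
    exists (sqrt (s / PI)); split; [now apply sqrt_lt_R0|].
    rewrite kmod'_km', pow2_sqrt by lra.
    replace (PI * (s / PI)) with s by (field; lra); easy.
Qed.
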